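(* Consider the two-group multi-block problem of the context under Assumptions 1, 2 and 3 there. Let $\{(x^k,y^k,\lambda^k)\}$ be generated by the algorithm of the context with parameters satisfying $$\rho=\frac{n\rho_x}{N}=\frac{m\rho_y}{M}>0 .$$ Assume $\frac nN=\frac mM=\theta$, and that $\hat P,\hat Q$ satisfy one of the following two conditions: (a) $\displaystyle \hat P\succeq(2-\theta)\Big(\frac{1-\theta}{\theta^2}+1\Big)\rho_xA^\top A+L_fI$ and $\displaystyle \hat Q\succeq\frac{2-\theta}{\theta^2}\rho_yB^\top B+L_gI$; (b) $\displaystyle \hat P_i\succeq(2-\theta)\Big(\frac{1-\theta}{\theta^2}+1\Big)n\rho_xA_i^\top A_i+L_fI$ for all $i$, and $\displaystyle \hat Q_j\succeq\frac{2-\theta}{\theta^2}m\rho_yB_j^\top B_j+L_gI$ for all $j$, where $\hat P_i$, $\hat Q_j$ are the $i$-th and $j$-th diagonal blocks of $\hat P$, $\hat Q$. For an integer $t\ge1$ let $$\hat x^t=\frac{x^{t+1}+\theta\sum_{k=1}^tx^k}{1+\theta t},\qquad\hat y^t=\frac{y^{t+1}+\theta\sum_{k=1}^ty^k}{1+\theta t}.$$ Then, for an arbitrary primal-dual solution $(x^*,y^*,\lambda^* )$, $$\max\Big\{\big|\mathbb E[\Phi(\hat x^t,\hat y^t)-\Phi(x^*,y^* )]\big|,\ \mathbb E\|A\hat x^t+B\hat y^t-b\|\Big\}$$ $$\le\frac1{1+\theta t}\Big[(1-\theta)\big(\Phi(x^0,y^0)-\Phi(x^*,y^* )+\rho_x\|r^0\|^2\big)+\frac12\|x^0-x^*\|_{\tilde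 P}^2+\frac12\|y^0-y^*\|_{\hat Q}^2+\frac{\max\{(1+\|\lambda^*\|)^2,4\|\lambda^*\|^2\}}{2\rho_x}\Big],$$ where $\tilde P=\hat P-\theta\rho_xA^\top A$.
   Context: Problem. $x=(x_1;\dots;x_N)$ and $y=(y_1;\dots;y_M)$ are real vectors partitioned into blocks; $A=(A_1,\dots,A_N)$, $B=(B_1,\dots,B_M)$ are conformally partitioned matrices; $b$ is a vector; $\mathcal X=\mathcal X_1\times\cdots\times\mathcal X_N$, $\mathcal Y=\mathcal Y_1\times\cdots\times\mathcal Y_M$; $u(x)=\sum_iu_i(x_i)$, $v(y)=\sum_jv_j(y_j)$, $F=f+u$, $G=g+v$, $\Phi(x,y)=F(x)+G(y)$. The problem is $\min\Phi(x,y)$ s.t. $Ax+By=b$, $x\in\mathcal X$, $y\in\mathcal Y$. Notation. $\|z\|_W^2:=z^\top Wz$ for a symmetric matrix $W$; $\|\cdot\|$ is the Euclidean norm; $W\succeq V$ means $W-V$ is positive semidefinite. For index sets $I\subset\{1,\dots,N\}$, $J\subset\{1,\dots,M\}$: $x_I$, $\mathcal X_I$, $A_I$, $\nabla_If$ are the sub-vector, product of sets, column-block sub-matrix and partial gradient indexed by $I$, $u_I(x_I)=\sum_{i\in I}u_i(x_i)$, and similarly $y_J,\mathcal Y_J,B_J,\nabla_Jg,v_J$. Assumption 1 (convexity): the $\mathcal X_i$, $\mathcal Y_j$ are closed convex sets, $f,g$ are smooth convex functions, the $u_i,v_j$ are proper closed convex (possibly nonsmooth) functions. Assumption 2 (existence):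 there is at least one primal-dual solution $(x^*,y^*,\lambda^* )$, i.e. $x^*\in\mathcal X$, $y^*\in\mathcal Y$, $Ax^*+By^*=b$ and $\Phi(x,y)-\Phi(x^*,y^* )-(x-x^* )^\top A^\top\lambda^*-(y-y^* )^\top B^\top\lambda^*\ge0$ for all $(x,y)\in\mathcal X\times\mathcal Y$. Assumption 3 (Lipschitz partial gradients): there are constants $L_f,L_g$ such that for every $I\subset\{1,\dots,N\}$ with $|I|=n$ and every $J\subset\{1,\dots,M\}$ with $|J|=m$, $\|\nabla_If(x+U_I\tilde x)-\nabla_If(x)\|\le L_f\|\tilde x_I\|$ for all $x,\tilde x$, and $\|\nabla_Jg(y+U_J\tilde y)-\nabla_Jg(y)\|\le L_g\|\tilde y_J\|$ for all $y,\tilde y$, where $U_I\tilde x$ keeps the blocks of $\tilde x$ indexed by $I$ and is zero elsewhere (similarly $U_J\tilde y$). Algorithm (RPDBU). Fix $1\le n\le N$, $1\le m\le M$, parameters $\rho,\rho_x,\rho_y>0$, symmetric positive semidefinite block diagonal matrices $\hat P,\hat Q$ (conformal with the blocks of $x$, resp. $y$), an initial point $x^0\in\mathcal X$, $y^0\in\mathcal Y$ with $\Phi(x^0,y^0)<\infty$, $\lambda^0=0$, $r^0=Ax^0+By^0-b$. For $k=0,1,\dots$: draw $I_k\subset\{1,\dots,N\}$ and then $J_k\subset\{1,\dots,M\}$ uniformly among all subsets of cardinality $n$ and $m$ respectively (each independently of all previous randomness). Set $x_i^{k+1}=x_i^k$ for $i\notin I_k$, $y_j^{k+1}=y_j^k$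 for $j\notin J_k$, and with $I=I_k$, $J=J_k$, $$x_I^{k+1}\in\arg\min_{x_I\in\mathcal X_I}\langle\nabla_If(x^k)-A_I^\top\lambda^k,x_I\rangle+u_I(x_I)+\tfrac{\rho_x}{2}\|A_I(x_I-x_I^k)+r^k\|^2+\tfrac12\|x_I-x_I^k\|_{P^k}^2,$$ $$r^{k+\frac12}=r^k+A_I(x_I^{k+1}-x_I^k),$$ $$y_J^{k+1}\in\arg\min_{y_J\in\mathcal Y_J}\langle\nabla_Jg(y^k)-B_J^\top\lambda^k,y_J\rangle+v_J(y_J)+\tfrac{\rho_y}{2}\|B_J(y_J-y_J^k)+r^{k+\frac12}\|^2+\tfrac12\|y_J-y_J^k\|_{Q^k}^2,$$ $$r^{k+1}=r^{k+\frac12}+B_J(y_J^{k+1}-y_J^k),\qquad\lambda^{k+1}=\lambda^k-\rho\,r^{k+1},$$ where $P^k=\hat P_{I_k}-\rho_xA_{I_k}^\top A_{I_k}$, $Q^k=\hat Q_{J_k}-\rho_yB_{J_k}^\top B_{J_k}$, and $\hat P_{I_k}$, $\hat Q_{J_k}$ denote the diagonal blocks of $\hat P$, $\hat Q$ indexed by $I_k$, $J_k$. *)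

(* Defs.v *)
From HB Require Import structures.
From mathcomp Require Import all_boot all_order all_algebra.
From mathcomp Require Import all_classical all_reals all_analysis.

Set Implicit Arguments.
Unset Strict Implicit.
Unset Printing Implicit Defensive.

Import Order.TTheory GRing.Theory Num.Theory.
Import numFieldNormedType.Exports.

Local Open Scope classical_set_scope.
Local Open Scope ring_scope.

(* The norm that mathcomp-analysis puts on matrices is the sup norm, hence the
   separate Euclidean norm [enorm]. *)
Section Euclidean.
Context {R : realType} {k : nat}.
Implicit Types (W V : 'M[R]_k) (z w : 'cV[R]_k).

Definition dot z w : R := (z^T *m w) 0 0.

Definition enorm z : R := Num.sqrt (dot z z).

Definition sqnorm W z : R := (z^T *m W *m z) 0 0.

Definition psd W : Prop := W^T = W /\ forall z, 0 <= sqnorm W z.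

Definition loewner_ge W V : Prop := psd (W - V).

Definition grad (f : 'cV[R]_k -> R) z : 'cV[R]_k :=
  \col_i 'D_(delta_mx i 0) f z.

Definition convex_efun (h : 'cV[R]_k -> \bar R) : Prop :=
  forall (s : R) z w, 0 <= s <= 1 ->
    (h (s *: z + (1 - s) *: w)%R <= s%:E * h z + (1 - s)%:E * h w)%E.

Definition proper_efun (h : 'cV[R]_k -> \bar R) : Prop :=
  (forall z, h z != -oo%E) /\ (exists z, (h z < +oo)%E).

(* Closed in the sense of convex analysis: the epigraph of [h] is closed,
   i.e. [h] is lower semicontinuous. *)
Definition proper_closed_convex (h : 'cV[R]_k -> \bar R) : Prop :=
  [/\ proper_efun h, lower_semicontinuous h & convex_efun h].

End Euclidean.

(* One of the two groups of variables: a vector with [N] blocks, block [i]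
   living in R^(p i), together with its matrix, constraint sets and
   objective. *)
Record group (R : realType) (N : nat) (p : 'I_N -> nat) (l : nat) := Group {
  coupling : 'M[R]_(l, \sum_i p i);
  feasible : forall i, set 'cV[R]_(p i);
  smooth_part : 'cV[R]_(\sum_i p i) -> R;
  nonsmooth_part : forall i, 'cV[R]_(p i) -> \bar R }.
Arguments feasible {R N p l} _ i.
Arguments nonsmooth_part {R N p l} _ i.

Section Group.
Context {R : realType} {N : nat} {p : 'I_N -> nat} {l : nat}.
Implicit Types (G : group R p l) (I : {set 'I_N}) (x z : 'cV[R]_(\sum_i p i)).
Implicit Types (W : 'M[R]_(\sum_i p i)) (lam r : 'cV[R]_l).

(* [restr I x] is U_I x. A sub-vector x_I is represented by its zero padding
   U_I x, so that A_I x_I is [A *m restr I x] and the norm of the partial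
   gradient indexed by I is [enorm (restr I (grad f x))]. *)
Definition restr I x : 'cV[R]_(\sum_i p i) :=
  \mxcol_i (if i \in I then submxcol x i else 0).

Definition block_diagonal W : Prop :=
  forall i j, i != j -> submxblock W i j = 0.

Definition in_feasible G x : Prop := forall i, feasible G i (submxcol x i).

Definition objective G x : \bar R :=
  ((smooth_part G x)%:E + \sum_i nonsmooth_part G i (submxcol x i))%E.

Definition convex_group G : Prop :=
  [/\ forall i, closed (feasible G i),
      forall i, convex_set (feasible G i : set (convex_lmodType 'cV[R]_(p i))),
      forall x, differentiable (smooth_part G) x,
      convex_function [set: convex_lmodType 'cV[R]_(\sum_i p i)]
        (smooth_part G)
    & forall i, proper_closed_convex (nonsmooth_part G i)].

Definition lipschitz_partial_grad G (n : nat) (L : R) : Prop :=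
  forall I, #|I| = n -> forall x z,
    enorm (restr I (grad (smooth_part G) (x + restr I z)
                    - grad (smooth_part G) x))
    <= L * enorm (restr I z).

(* The function minimized over z_I; it depends on z only through the blocks
   indexed by I. For d_I = (z - x)_I with zero padding d, the form given by
   W_I - rho A_I^T A_I at d_I is the one given by W - rho A^T A at d. *)
Definition subproblem G W (rho : R) I x lam r z : \bar R :=
  let A := coupling G in
  let d := restr I (z - x) in
  ((dot (grad (smooth_part G) x - A^T *m lam) (restr I z)
    + rho / 2 * enorm (A *m d + r) ^+ 2
    + 2^-1 * sqnorm (W - rho *: (A^T *m A)) d)%:E
   + \sum_(i in I) nonsmooth_part G i (submxcol z i))%E.

(* [x'] results from [x] by updating the blocks indexed by [I]. *)
Definition block_update G W (rho : R) I x lam r x' : Prop :=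
  [/\ forall i, i \notin I -> submxcol x' i = submxcol x i,
      forall i, i \in I -> feasible G i (submxcol x' i)
    & forall z, (forall i, i \in I -> feasible G i (submxcol z i)) ->
        (subproblem G W rho I x lam r x'
         <= subproblem G W rho I x lam r z)%E].

Definition matrix_cond_joint G W (c L : R) : Prop :=
  loewner_ge W (c *: ((coupling G)^T *m coupling G) + L%:M).

Definition matrix_cond_blockwise G W (c L : R) : Prop :=
  forall i, loewner_ge (submxblock W i i)
    (c *: ((submxrow (coupling G) i)^T *m submxrow (coupling G) i) + L%:M).

Definition weighted_average (theta : R) (t : nat)
    (x : nat -> 'cV[R]_(\sum_i p i)) : 'cV[R]_(\sum_i p i) :=
  (1 + theta * t%:R)^-1 *:
    (x t.+1 + theta *: \sum_(1 <= k < t.+1) x k).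

End Group.

Section Problem.
Context {R : realType} {N M : nat} {p : 'I_N -> nat} {q : 'I_M -> nat}.
Context {l : nat}.
Variables (GX : group R p l) (GY : group R q l) (b : 'cV[R]_l).
Implicit Types (x : 'cV[R]_(\sum_i p i)) (y : 'cV[R]_(\sum_j q j)).

Definition total_objective x y : \bar R := (objective GX x + objective GY y)%E.

Definition residual x y : 'cV[R]_l := coupling GX *m x + coupling GY *m y - b.

Definition primal_dual_solution x y (lam : 'cV[R]_l) : Prop :=
  [/\ in_feasible GX x, in_feasible GY y, residual x y = 0
    & forall x' y', in_feasible GX x' -> in_feasible GY y' ->
        (0 <= total_objective x' y' - total_objective x y
              - (dot (x' - x) ((coupling GX)^T *m lam))%:E
              - (dot (y' - y) ((coupling GY)^T *m lam))%:E)%E].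

End Problem.

Section Draws.
Context {R : realType} {d : measure_display} {T : measurableType d}.
Context {N M : nat}.
Variables (I : nat -> T -> {set 'I_N}) (J : nat -> T -> {set 'I_M}).

Definition drawn_before (k : nat) (S : nat -> {set 'I_N})
    (V : nat -> {set 'I_M}) : set T :=
  [set w | forall j, (j < k)%N -> I j w = S j /\ J j w = V j].

(* The draws happen in the order I_0, J_0, I_1, J_1, ... *)
Definition uniform_draws (Pr : probability T R) (n m : nat) : Prop :=
  [/\ forall k w, #|I k w| = n /\ #|J k w| = m,
      forall k (S : {set 'I_N}) (V : {set 'I_M}),
        measurable [set w | I k w = S]
        /\ measurable [set w | J k w = V],
      forall k (S : {set 'I_N}) (V : {set 'I_M}),
        (#|S| = n -> Pr [set w | I k w = S] = (('C(N, n))%:R^-1)%:E)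
        /\ (#|V| = m -> Pr [set w | J k w = V] = (('C(M, m))%:R^-1)%:E),
      forall k S V (S' : {set 'I_N}),
        Pr (drawn_before k S V `&` [set w | I k w = S'])
        = (Pr (drawn_before k S V) * Pr [set w | I k w = S'])%E
    & forall k S V (S' : {set 'I_N}) (V' : {set 'I_M}),
        Pr (drawn_before k S V `&` [set w | I k w = S']
            `&` [set w | J k w = V'])
        = (Pr (drawn_before k S V `&` [set w | I k w = S'])
           * Pr [set w | J k w = V'])%E].

Definition same_draws_before (k : nat) (w w' : T) : Prop :=
  forall j, (j < k)%N -> I j w = I j w' /\ J j w = J j w'.

(* The draws are the only source of randomness: x^{k+1} is a function of
   I_0, J_0, ..., I_{k-1}, J_{k-1}, I_k, and y^{k+1} of these and J_k. This
   matters only where an argmin is not unique. *)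
Definition nonanticipating {X Y : Type} (x : nat -> T -> X)
    (y : nat -> T -> Y) : Prop :=
  forall k w w', same_draws_before k w w' -> I k w = I k w' ->
    x k.+1 w = x k.+1 w' /\ (J k w = J k w' -> y k.+1 w = y k.+1 w').

End Draws.

Section Algorithm.
Context {R : realType} {d : measure_display} {T : measurableType d}.
Context {N M : nat} {p : 'I_N -> nat} {q : 'I_M -> nat} {l : nat}.

Definition rpdbu (GX : group R p l) (GY : group R q l) (b : 'cV[R]_l)
    (Pr : probability T R) (n m : nat) (rho rho_x rho_y : R)
    (Phat : 'M[R]_(\sum_i p i)) (Qhat : 'M[R]_(\sum_j q j))
    (x0 : 'cV[R]_(\sum_i p i)) (y0 : 'cV[R]_(\sum_j q j))
    (I : nat -> T -> {set 'I_N}) (J : nat -> T -> {set 'I_M})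
    (x : nat -> T -> 'cV[R]_(\sum_i p i))
    (y : nat -> T -> 'cV[R]_(\sum_j q j))
    (lam r : nat -> T -> 'cV[R]_l) : Prop :=
  [/\ uniform_draws I J Pr n m,
      nonanticipating I J x y,
      forall w, [/\ x 0%N w = x0, y 0%N w = y0, lam 0%N w = 0
                  & r 0%N w = residual GX GY b x0 y0]
    & forall k w,
        let r_half := r k w
          + coupling GX *m restr (I k w) (x k.+1 w - x k w) in
        [/\ block_update GX Phat rho_x (I k w) (x k w) (lam k w) (r k w)
              (x k.+1 w),
            block_update GY Qhat rho_y (J k w) (y k w) (lam k w) r_half
              (y k.+1 w),
            r k.+1 w = r_half
              + coupling GY *m restr (J k w) (y k.+1 w - y k w)
          & lam k.+1 w = lam k w - rho *: r k.+1 w]].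

End Algorithm.

(* Main.v *)
Require Import Defs.
From HB Require Import structures.
From mathcomp Require Import all_boot all_order all_algebra.
From mathcomp Require Import all_classical all_reals all_analysis.
From mathcomp Require Import ring lra.

Set Implicit Arguments.
Unset Strict Implicit.
Unset Printing Implicit Defensive.

Import Order.TTheory GRing.Theory Num.Theory.
Import numFieldNormedType.Exports.

Local Open Scope ring_scope.

(* Put beta = rho_x = rho_y. The optimality of each block update and the descent
   lemma bound the decrease of the objective by the partial sums, over the drawn
   blocks, of the gaps <grad_i + A_i^T (beta r - lam), x_i - xs_i> + u_i(x_i) -
   u_i(xs_i). A uniform draw turns such a partial sum into theta times the full
   sum plus a term of mean zero, and convexity bounds the full sum below. For
   every multiplier mu the resulting one-step inequality telescopes with the
   Lyapunov function [lyapunov mu], and the mean-zero terms do not involve mu, so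
   mu may be chosen along the averaged residual, separately on each sample path.
   All random variables factor through the finite history of draws, so
   expectations are finite sums. *)

(** The bound concerns the mean of the norm of the residual. A multiplier fixed before taking
    expectations would control only the norm of the mean, hence the need for one that varies with
    the sample path. The averages may violate the coupling constraint, so the objective gap can be
    negative; the primal-dual inequality bounds its mean below by minus [enorm lams] times the mean
    residual norm. Penalizing the residual with weight [gamma] costs [gamma ^+ 2 / (2 * beta)], and
    the two weights [1 + enorm lams] and [2 * enorm lams] produce the maximum in the bound. Each
    step retains the share [1 - theta] of the previous gap and residual. The usual multiplier term
    |mu - lam|^2 / (2 beta) of the alternating direction method does not telescope against this, and
    [potential] adds a cross term with the residual that does. *)

(** * Euclidean inner product and quadratic forms *)

Section Dot.
Context {R : realType} {k : nat}.
Implicit Types (W V : 'M[R]_k) (z w v : 'cV[R]_k).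

Lemma dotE z w : dot z w = \sum_i z i 0 * w i 0.
Proof. by rewrite /dot mxE; apply: eq_bigr => i _; rewrite mxE. Qed.

Lemma dotC z w : dot z w = dot w z.
Proof. by rewrite !dotE; apply: eq_bigr => i _; rewrite mulrC. Qed.

Lemma dotDl z w v : dot (z + w) v = dot z v + dot w v.
Proof. by rewrite /dot linearD mulmxDl mxE. Qed.

Lemma dotDr z w v : dot v (z + w) = dot v z + dot v w.
Proof. by rewrite dotC dotDl !(dotC v). Qed.

Lemma dotZl (a : R) z w : dot (a *: z) w = a * dot z w.
Proof. by rewrite /dot linearZ -scalemxAl mxE. Qed.

Lemma dotZr (a : R) z w : dot z (a *: w) = a * dot z w.
Proof. by rewrite dotC dotZl dotC. Qed.

Lemma dotNl z w : dot (- z) w = - dot z w.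
Proof. by rewrite -scaleN1r dotZl mulN1r. Qed.

Lemma dotNr z w : dot z (- w) = - dot z w.
Proof. by rewrite dotC dotNl dotC. Qed.

Lemma dot0l z : dot 0 z = 0.
Proof. by rewrite -(scale0r 0) dotZl mul0r. Qed.

Lemma dot0r z : dot z 0 = 0.
Proof. by rewrite dotC dot0l. Qed.

Lemma dot_sumr (I : Type) (s : seq I) (P : pred I) (F : I -> 'cV[R]_k) z :
  dot z (\sum_(i <- s | P i) F i) = \sum_(i <- s | P i) dot z (F i).
Proof.
by apply: (big_morph (dot z)) => [u v|]; [apply: dotDr | apply: dot0r].
Qed.

Lemma dotvv_ge0 z : 0 <= dot z z.
Proof. by rewrite dotE sumr_ge0 // => i _; rewrite -expr2 sqr_ge0. Qed.

Lemma dotvv_eq0 z : (dot z z == 0) = (z == 0).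
Proof.
apply/eqP/eqP => [|->]; last by rewrite dot0l.
rewrite dotE => /eqP; rewrite psumr_eq0 => [/allP h|i _]; last first.
  by rewrite -expr2 sqr_ge0.
apply/matrixP => i j; rewrite ord1 mxE.
by have := h i (mem_index_enum i); rewrite mulf_eq0 orbb => /eqP.
Qed.

Lemma enorm_ge0 z : 0 <= enorm z.
Proof. exact: sqrtr_ge0. Qed.

Lemma sqr_enorm z : enorm z ^+ 2 = dot z z.
Proof. by rewrite sqr_sqrtr // dotvv_ge0. Qed.

Lemma enorm_eq0 z : (enorm z == 0) = (z == 0).
Proof. by rewrite sqrtr_eq0 le_eqVlt ltNge dotvv_ge0 orbF dotvv_eq0. Qed.

(** Cauchy-Schwarz, from expanding the square of |w| z - |z| w into 2 |z| |w| (|z| |w| - <z, w>). *)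
Lemma dot_le_enormM z w : dot z w <= enorm z * enorm w.
Proof.
have [->|w0] := eqVneq w 0; first by rewrite dot0r mulr_ge0 ?enorm_ge0.
have w1 : 0 < enorm w by rewrite lt_def enorm_eq0 w0 enorm_ge0.
have [->|z0] := eqVneq z 0; first by rewrite dot0l mulr_ge0 ?enorm_ge0.
have z1 : 0 < enorm z by rewrite lt_def enorm_eq0 z0 enorm_ge0.
have := dotvv_ge0 (enorm w *: z - enorm z *: w).
suff -> : dot (enorm w *: z - enorm z *: w) (enorm w *: z - enorm z *: w)
    = 2 * (enorm z * enorm w) * (enorm z * enorm w - dot z w).
  by rewrite pmulr_rge0 ?subr_ge0 // !mulr_gt0.
rewrite !(dotDl, dotDr, dotNl, dotNr, dotZl, dotZr) -(sqr_enorm z).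
by rewrite -(sqr_enorm w) (dotC w z); ring.
Qed.

Lemma normr_dot_le z w : `|dot z w| <= enorm z * enorm w.
Proof.
rewrite ler_norml dot_le_enormM andbT lerNl -dotNl.
by rewrite (le_trans (dot_le_enormM _ _)) // /enorm dotNl dotNr opprK.
Qed.

Lemma sqnormE W z : sqnorm W z = dot z (W *m z).
Proof. by rewrite /sqnorm /dot mulmxA. Qed.

Lemma sqnormDl W V z : sqnorm (W + V) z = sqnorm W z + sqnorm V z.
Proof. by rewrite !sqnormE mulmxDl dotDr. Qed.

Lemma sqnormZl (a : R) W z : sqnorm (a *: W) z = a * sqnorm W z.
Proof. by rewrite !sqnormE -scalemxAl dotZr. Qed.

Lemma sqnormNl W z : sqnorm (- W) z = - sqnorm W z.
Proof. by rewrite -scaleN1r sqnormZl mulN1r. Qed.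

Lemma sqnorm_scalar (a : R) z : sqnorm a%:M z = a * dot z z.
Proof. by rewrite sqnormE mul_scalar_mx dotZr. Qed.

End Dot.

Lemma dot_trmx {R : realType} {k l : nat} (A : 'M[R]_(l, k)) u z :
  dot (A^T *m u) z = dot u (A *m z).
Proof. by rewrite /dot trmx_mul trmxK mulmxA. Qed.

Lemma psd_dotC {R : realType} {k : nat} (W : 'M[R]_k) z w :
  psd W -> dot z (W *m w) = dot w (W *m z).
Proof. by case=> WT _; rewrite -dot_trmx WT dotC. Qed.

Lemma sqnorm_gram {R : realType} {k l : nat} (A : 'M[R]_(l, k)) z :
  sqnorm (A^T *m A) z = dot (A *m z) (A *m z).
Proof. by rewrite sqnormE dotC -mulmxA dot_trmx. Qed.

(** Each cross product in the double sum is at most the mean of two squares. The factor [#|A|] is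
    the origin of the factors n and m in the blockwise matrix conditions. *)
Lemma dot_sum_le {R : realType} {k : nat} (I : finType) (A : {set I})
    (F : I -> 'cV[R]_k) :
  dot (\sum_(i in A) F i) (\sum_(i in A) F i)
  <= #|A|%:R * \sum_(i in A) dot (F i) (F i).
Proof.
rewrite dot_sumr mulr_sumr.
have -> : \sum_(i in A) dot (\sum_(j in A) F j) (F i)
   = \sum_(i in A) \sum_(j in A) dot (F i) (F j).
  by apply: eq_bigr => i _; rewrite dotC dot_sumr.
have -> : \sum_(i in A) #|A|%:R * dot (F i) (F i)
   = \sum_(i in A) \sum_(j in A) (dot (F i) (F i) + dot (F j) (F j)) / 2.
  under [RHS]eq_bigr do under eq_bigr do rewrite mulrDl.
  under [RHS]eq_bigr do rewrite big_split sumr_const /=.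
  rewrite big_split sumr_const /= -sumrMnl -big_split /=.
  by apply: eq_bigr => i _; rewrite -mulrnDl -splitr mulr_natl.
apply: ler_sum => i _; apply: ler_sum => j _.
have := dotvv_ge0 (F i - F j).
rewrite !(dotDl, dotDr, dotNl, dotNr) (dotC (F j) (F i)); lra.
Qed.

(** * Block restriction and the two matrix conditions *)

Section Blocks.
Context {R : realType} {N : nat} {p : 'I_N -> nat} {l : nat}.
Implicit Types (I : {set 'I_N}) (x z : 'cV[R]_(\sum_i p i)).
Implicit Types (W : 'M[R]_(\sum_i p i)) (A : 'M[R]_(l, \sum_i p i)).

Lemma submxcol_restr I x i :
  submxcol (restr I x) i = if i \in I then submxcol x i else 0.
Proof. by rewrite /restr mxcolK. Qed.

Lemma submxcolZ (a : R) x i : submxcol (a *: x) i = a *: submxcol x i.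
Proof. by apply/colP => j; rewrite !mxE. Qed.

Lemma restrD I x z : restr I (x + z) = restr I x + restr I z.
Proof.
apply/mxcolP => i; rewrite submxcolD !submxcol_restr submxcolD.
by case: ifP; rewrite ?addr0.
Qed.

Lemma restrZ I (a : R) x : restr I (a *: x) = a *: restr I x.
Proof.
apply/mxcolP => i; rewrite submxcolZ !submxcol_restr submxcolZ.
by case: ifP; rewrite ?scaler0.
Qed.

Lemma restrN I x : restr I (- x) = - restr I x.
Proof. by rewrite -[- x]scaleN1r restrZ scaleN1r. Qed.

Lemma restrB I x z : restr I (x - z) = restr I x - restr I z.
Proof. by rewrite restrD restrN. Qed.

Lemma restrT x : restr [set: 'I_N] x = x.
Proof. by apply/mxcolP => i; rewrite submxcol_restr finset.in_setT. Qed.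

Lemma restr_supp I x :
  (forall i, i \notin I -> submxcol x i = 0) -> restr I x = x.
Proof.
move=> h; apply/mxcolP => i; rewrite !submxcol_restr.
by case: ifPn => // /h ->.
Qed.

Lemma restr_sum I x : restr I x = \sum_(i in I) restr [set i] x.
Proof.
apply/mxcolP => i; rewrite submxcol_restr submxcol_sum.
under eq_bigr do rewrite submxcol_restr finset.inE eq_sym.
rewrite -big_mkcondr /=; case: ifPn => iI.
  by rewrite (bigD1 i) ?iI ?eqxx //= big1 ?addr0 // => j /andP[/andP[_ /eqP->]];
     rewrite eqxx.
by rewrite big1 // => j /andP[jI /eqP ji]; move: iI; rewrite -ji jI.
Qed.

Lemma dot_blocks x z :
  dot x z = \sum_i dot (submxcol x i) (submxcol z i).
Proof.
rewrite {1}/dot -{1}(submxcolK x) -{1}(submxcolK z) tr_mxcol mul_mxrow_mxcol.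
by rewrite summxE.
Qed.

Lemma dot_restr I x z : dot (restr I x) z = dot x (restr I z).
Proof.
rewrite !dot_blocks; apply: eq_bigr => i _; rewrite !submxcol_restr.
by case: ifP; rewrite ?dot0l ?dot0r.
Qed.

Lemma mulmx_blocks (k : nat) (A : 'M[R]_(k, \sum_i p i)) z :
  A *m z = \sum_i submxrow A i *m submxcol z i.
Proof.
by rewrite -{1}(submxcolK z) -{1}(submxrowK A) mul_mxrow_mxcol.
Qed.

Lemma mulmx_restr1 A z i :
  A *m restr [set i] z = submxrow A i *m submxcol z i.
Proof.
rewrite mulmx_blocks (bigD1 i) //= big1 ?addr0 ?submxcol_restr ?finset.inE ?eqxx //.
by move=> j ji; rewrite submxcol_restr finset.inE (negbTE ji) mulmx0.
Qed.

Lemma submxcol_mulmx W z i : block_diagonal W ->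
  submxcol (W *m z) i = submxblock W i i *m submxcol z i.
Proof.
move=> Wd; rewrite -submxcol_mul mulmx_blocks (bigD1 i) //= -submxblockEv.
by rewrite big1 ?addr0 // => j ji; rewrite -submxblockEv Wd ?mul0mx // eq_sym.
Qed.

Lemma mulmx_restr_diag W I z : block_diagonal W ->
  W *m restr I z = restr I (W *m z).
Proof.
move=> Wd; apply/mxcolP => i; rewrite submxcol_mulmx // !submxcol_restr.
by rewrite submxcol_mulmx //; case: ifP; rewrite ?mulmx0.
Qed.

Lemma sqnorm_blocks W z : block_diagonal W ->
  sqnorm W z = \sum_i sqnorm (submxblock W i i) (submxcol z i).
Proof.
move=> Wd; rewrite sqnormE dot_blocks; apply: eq_bigr => i _.
by rewrite submxcol_mulmx // sqnormE.
Qed.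

Lemma loewner_ge_sqnorm (k : nat) (W V : 'M[R]_k) (z : 'cV[R]_k) :
  loewner_ge W V -> sqnorm V z <= sqnorm W z.
Proof. by case=> _ /(_ z); rewrite sqnormDl sqnormNl subr_ge0. Qed.

Lemma sqnorm_ge_joint (G : group R p l) W (c L : R) z :
  matrix_cond_joint G W c L ->
  c * dot (coupling G *m z) (coupling G *m z) + L * dot z z <= sqnorm W z.
Proof.
move/loewner_ge_sqnorm => /(_ z).
by rewrite sqnormDl sqnormZl sqnorm_gram sqnorm_scalar.
Qed.

(** Block diagonality reduces the form of [W] to single blocks; reassembling the images of the
    blocks in [I] by [dot_sum_le] loses the factor [#|I|], which [c] has to absorb. *)
Lemma sqnorm_ge_blockwise (G : group R p l) W (c k L : R) I z :
  block_diagonal W -> matrix_cond_blockwise G W c L ->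
  0 <= k -> #|I|%:R * k <= c -> restr I z = z ->
  k * dot (coupling G *m z) (coupling G *m z) + L * dot z z <= sqnorm W z.
Proof.
move=> Wd Wc k0 kc Iz; set A := coupling G.
pose D i := dot (A *m restr [set i] z) (A *m restr [set i] z).
have Wge : \sum_i (c * D i + L * dot (submxcol z i) (submxcol z i))
    <= sqnorm W z.
  rewrite sqnorm_blocks //; apply: ler_sum => i _.
  have := loewner_ge_sqnorm (submxcol z i) (Wc i).
  by rewrite sqnormDl sqnormZl sqnorm_gram sqnorm_scalar -mulmx_restr1.
apply: le_trans Wge; rewrite big_split /= -!mulr_sumr -dot_blocks lerD2r.
have D0 i : 0 <= D i by apply: dotvv_ge0.
have : dot (A *m z) (A *m z) <= #|I|%:R * \sum_(i in I) D i.
  by rewrite -{1 2}Iz restr_sum mulmx_sumr dot_sum_le.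
move=> /(ler_wpM2l k0) h; apply: (le_trans h).
rewrite mulrA (mulrC k); apply: ler_pM => //.
- by rewrite mulr_ge0.
- exact: sumr_ge0.
- by rewrite [leRHS](bigID (mem I)) /= lerDl sumr_ge0.
Qed.

End Blocks.

(** * Counting draws that contain a given block *)

(** The draws that avoid [i] are the draws from its complement, so Pascal's rule leaves C(N-1, n)
    draws with [i]. *)
Lemma card_draws_mem (N n : nat) (i : 'I_N) :
  (N * #|[set A : {set 'I_N} | (#|A| == n.+1) && (i \in A)]|
   = n.+1 * 'C(N, n.+1))%N.
Proof.
have cT := cards_draws [set: 'I_N] n.+1.
have cD := cards_draws [set~ i] n.+1.
rewrite cardsT card_ord in cT; rewrite cardsC1 card_ord in cD.
have NE : N.-1.+1 = N by case: N i {cT cD} => [[]|].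
have binN : ('C(N, n.+1) = 'C(N.-1, n.+1) + 'C(N.-1, n))%N.
  by rewrite -{1}NE binS.
rewrite -mul_bin_diag; congr (_ * _)%N.
apply/eqP; rewrite -(eqn_add2l 'C(N.-1, n.+1)) -binN -cT -{1}cD.
rewrite -(cardsID [set A : {set 'I_N} | i \in A]
   [set A : {set 'I_N} | A \subset [set: 'I_N] & #|A| == n.+1]).
rewrite addnC; apply/eqP; congr (_ + _)%N; apply: eq_card => A; rewrite !finset.inE.
  by rewrite finset.subsetT.
by rewrite finset.subsetT finset.subsetC finset.sub1set finset.inE andbC.
Qed.

Lemma ex_draw_mem (N n : nat) (i : 'I_N) : (0 < n <= N)%N ->
  exists2 A : {set 'I_N}, #|A| = n & i \in A.
Proof.
case: n => // n /andP[_ nN]; have := card_draws_mem n i.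
set D := [set _ | _]; have [->|[A]] := set_0Vmem D; last first.
  by rewrite finset.inE => /andP[/eqP cA iA]; exists A.
by rewrite cards0 muln0 => /esym/eqP; rewrite muln_eq0 /= -leqn0 leqNgt bin_gt0 nN.
Qed.

(** [L] carries no sign hypothesis. If [L < 0], the Lipschitz bound makes every restriction of [z]
    to [n] blocks vanish, and each block lies in some such draw, so [z = 0]. *)
Lemma lipschitz_dot_ge0 {R : realType} {N : nat} {p : 'I_N -> nat} {l : nat}
    (G : group R p l) (n : nat) (L : R) (z : 'cV[R]_(\sum_i p i)) :
  (0 < n <= N)%N -> lipschitz_partial_grad G n L -> 0 <= L * dot z z.
Proof.
move=> nN GL; have [L0|L0] := leP 0 L; first by rewrite mulr_ge0 ?dotvv_ge0.
suff -> : z = 0 by rewrite dot0l mulr0.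
apply/mxcolP => i; have [A cA iA] := ex_draw_mem i nN.
have := le_trans (enorm_ge0 _) (GL A cA 0 z).
rewrite nmulr_rge0 // => Az; have /eqP : enorm (restr A z) == 0.
  by rewrite eq_le Az enorm_ge0.
move/eqP; rewrite enorm_eq0 => /eqP/(congr1 (fun v => submxcol v i)).
by rewrite /= submxcol_restr iA submxcol0.
Qed.

(** * First-order conditions, gradient inequality and descent lemma *)

Lemma ge0_of_quadratic {R : realType} (a b : R) :
  (forall s, 0 < s <= 1 -> 0 <= s * a + s ^+ 2 * b) -> 0 <= a.
Proof.
move=> h; rewrite leNgt; apply/negP => a0.
have b0 : 0 <= b by have := h 1; rewrite ltr01 lexx expr1n => /(_ isT); lra.
have ab : 0 < b - a by lra.
(* With this [s], a + s b = a / 2 + s a, which is negative. *)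
pose s := - a / (2 * (b - a)).
have s0 : 0 < s by rewrite divr_gt0 ?oppr_gt0 ?mulr_gt0.
have s1 : s <= 1 by rewrite /s ler_pdivrMr ?mulr_gt0 //; lra.
have := h s; rewrite s0 s1 => /(_ isT).
rewrite expr2 -mulrA -mulrDr pmulr_rge0 //.
have sE : s * (2 * (b - a)) = - a.
  by rewrite /s mulfVK // gt_eqF // mulr_gt0.
have : s * a <= 0 by rewrite pmulr_rle0 // ltW.
lra.
Qed.

(** Were [C < D], the difference quotients near 0 would exceed [C]. Applied to a convex function on
    a segment, it gives the gradient inequality. *)
Lemma derive1_le_chord {R : realType} (f : R -> R) (D C : R) :
  is_derive (0 : R) 1 f D -> (forall s, 0 < s <= 1 -> f s <= f 0 + s * C) -> D <= C.
Proof.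
move=> fD fC; rewrite leNgt; apply/negP => CD.
have fdv : derivable f 0 1 by [].
have Dlim : 'D_1 f 0 = D by exact: derive_val.
have : ((fun h => h^-1 *: ((f \o shift 0) (h *: 1) - f 0)) @ 0^' --> D)%classic.
  by rewrite -Dlim; apply: fdv.
move/(cvgr_gt D) => /(_ C CD) [e /= e0 he].
pose s := Num.min (e / 2) 1.
have s0 : 0 < s by rewrite lt_min ltr01 divr_gt0.
have s1 : s <= 1 by rewrite ge_min lexx orbT.
have se : s < e by rewrite gt_min; apply/orP; left; lra.
have := he s; rewrite /= /ball_ /= sub0r normrN gtr0_norm // => /(_ se).
rewrite gt_eqF // => /(_ isT); rewrite addr0.
have -> : s *: (1 : R) = s by rewrite /GRing.scale /= mulr1.
rewrite /GRing.scale /= mulrC ltr_pdivlMr // mulrC ltNge => /negP; apply.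
by rewrite lerBlDl fC // s0.
Qed.

Section Gradient.
Context {R : realType} {k : nat}.
Variable f : 'cV[R]_k -> R.
Hypothesis df : forall x, differentiable f x.
Implicit Types x z v : 'cV[R]_k.

(** [grad] collects partial derivatives only; differentiability makes the derivative linear in the
    direction. *)
Lemma dot_grad x v : dot (grad f x) v = 'D_v f x.
Proof.
rewrite deriveE // {2}[v]matrix_sum_delta linear_sum /= dotE.
apply: eq_bigr => i _; rewrite big_ord1 mxE deriveE // linearZ /=.
by rewrite mulrC.
Qed.

Lemma is_derive_line x v (s : R) :
  is_derive (s : R) 1 (fun s : R => f (x + s *: v)) (dot (grad f (x + s *: v)) v).
Proof.
have E : (fun h : R => h^-1 *: (((fun s : R => f (x + s *: v)) \o shift s)
     (h *: (1 : R)) - f (x + s *: v)))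
  = (fun h : R => h^-1 *: ((f \o shift (x + s *: v)) (h *: v)
      - f (x + s *: v))).
  apply/funext => h /=; congr (_ *: (f _ - _)).
  by rewrite scalerDl addrCA /GRing.scale /= mulr1.
split; first by rewrite /derivable E; apply: diff_derivable.
by rewrite /derive E -/(derive f _ _) dot_grad.
Qed.

Lemma convex_grad_le x z :
  convex_function [set: convex_lmodType 'cV[R]_k]%classic f ->
  f x + dot (grad f x) (z - x) <= f z.
Proof.
move=> cf; rewrite -lerBrDl.
have := is_derive_line x (z - x) 0; rewrite scale0r addr0 => h.
apply: (derive1_le_chord h) => s /andP[s0 s1].
rewrite scale0r addr0.
have s01 : 0 <= s <= 1 by rewrite ltW.
have := cf (Itv01 (ltW s0) s1) z x.
rewrite !in_setT => /(_ isT isT).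
rewrite /conv /= /conv /= /unstable.onem.
have -> : s *: z + (1 - s) *: x = x + s *: (z - x).
  by rewrite scalerBl scale1r scalerBr addrC addrAC addrA.
by rewrite /GRing.scale /=; lra.
Qed.

(** The mean value theorem takes the place of integrating the gradient along the segment: [g] is [f]
    minus its quadratic model and has nonpositive slope on (0, 1). *)
Lemma descent x v (L : R) :
  (forall s : R, 0 < s < 1 ->
     dot (grad f (x + s *: v) - grad f x) v <= L * s * dot v v) ->
  f (x + v) <= f x + dot (grad f x) v + L / 2 * dot v v.
Proof.
move=> hL.
pose c := dot (grad f x) v; pose e := L / 2 * dot v v.
pose g (s : R) := f (x + s *: v) - s * c - s ^+ 2 * e.
pose dg (s : R) := dot (grad f (x + s *: v)) v - c - s * 2 * e.
have gd (s : R) : is_derive s 1 g (dg s).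
  have h := is_derive_line x v s.
  apply: is_derive_eq; rewrite /dg /GRing.scale /=; ring.
have gc : {within `[0, 1], continuous g}%classic.
  by apply: derivable_within_continuous => s _; apply: ex_derive.
have [s] := MVT ltr01 (fun s _ => gd s) gc.
rewrite in_itv /= => s01 E; have := hL s s01.
rewrite dotDl dotNl -/c => h.
have : dg s <= 0 by rewrite /dg /e; lra.
have -> : dg s = g 1 - g 0 by rewrite E subr0 mulr1.
by rewrite /g scale1r scale0r addr0 mul0r !expr2 !mul0r !mul1r /e; lra.
Qed.

End Gradient.

(** Since [v] lives on the blocks of [I], its product with a gradient difference sees only the
    partial gradient, to which the Lipschitz assumption applies. *)
Lemma restr_descent {R : realType} {N : nat} {p : 'I_N -> nat} {l : nat}
    (G : group R p l) (n : nat) (L : R) (I : {set 'I_N})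
    (x v : 'cV[R]_(\sum_i p i)) :
  (forall x, differentiable (smooth_part G) x) ->
  lipschitz_partial_grad G n L -> #|I| = n -> restr I v = v ->
  smooth_part G (x + v) <= smooth_part G x
    + dot (grad (smooth_part G) x) v + L / 2 * dot v v.
Proof.
move=> dG GL cI Iv; apply: descent => // s /andP[s0 s1].
set D := _ - _.
have -> : dot D v = dot (restr I D) v by rewrite dot_restr Iv.
apply: (le_trans (dot_le_enormM _ _)).
have := GL I cI x (s *: v); rewrite restrZ Iv -/D => h.
apply: (le_trans (ler_wpM2r _ h)); first exact: enorm_ge0.
have -> : enorm (s *: v) = s * enorm v.
  rewrite /enorm dotZl dotZr mulrA -expr2 sqrtrM ?sqr_ge0 //.
  by rewrite sqrtr_sqr gtr0_norm.
by rewrite -(sqr_enorm v) expr2 !mulrA.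
Qed.

(** * Effective domain and real-valued objective *)

Lemma fin_num_of_sum_lty {R : realType} (I : finType) (P : pred I)
    (F : I -> \bar R) :
  (forall i, F i != -oo%E) -> (\sum_(i | P i) F i < +oo)%E ->
  forall i, P i -> F i \is a fin_num.
Proof.
move=> Fn Fs i Pi; rewrite fin_numE Fn /=; apply/negP => /eqP Fi.
move: Fs; rewrite lt_neqAle => /andP[/negP]; case.
by rewrite esum_eqy //; apply/existsP; exists i; apply/andP; split => //; apply/eqP.
Qed.

Section Domain.
Context {R : realType} {N : nat} {p : 'I_N -> nat} {l : nat}.
Implicit Types (G : group R p l) (I : {set 'I_N}) (x z : 'cV[R]_(\sum_i p i)).
Implicit Types (W : 'M[R]_(\sum_i p i)) (lam r : 'cV[R]_l).

Definition in_block_domain G i (v : 'cV[R]_(p i)) : Prop :=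
  feasible G i v /\ nonsmooth_part G i v \is a fin_num.

Definition in_domain G x : Prop := forall i, in_block_domain G (submxcol x i).

(** [fine] sends infinite values to 0, so this is meaningful on [in_domain] only. Iterates, averages
    and solutions all lie there, which allows the arithmetic to stay in [R]. *)
Definition nonsmooth_value G i x : R := fine (nonsmooth_part G i (submxcol x i)).

Definition objective_value G x : R :=
  smooth_part G x + \sum_i nonsmooth_value G i x.

Lemma sum_nonsmoothE G I x :
  (forall i, i \in I -> nonsmooth_part G i (submxcol x i) \is a fin_num) ->
  (\sum_(i in I) nonsmooth_part G i (submxcol x i))%E
  = (\sum_(i in I) nonsmooth_value G i x)%:E.
Proof.
by move=> xd; rewrite -sumEFin; apply: eq_bigr => i /xd h; rewrite fineK.
Qed.

Lemma objectiveE G x : in_domain G x -> objective G x = (objective_value G x)%:E.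
Proof.
move=> xd; rewrite /objective EFinD; congr (_ + _)%E.
by rewrite -sumEFin; apply: eq_bigr => i _; case: (xd i) => _ h; rewrite fineK.
Qed.

Lemma in_domain_feasible G x : in_domain G x -> in_feasible G x.
Proof. by move=> xd i; case: (xd i). Qed.

Lemma nonsmooth_neqNy G i v : convex_group G -> nonsmooth_part G i v != -oo%E.
Proof. by case=> _ _ _ _ /(_ i) [[]] + _ _ _. Qed.

Lemma objective_neqNy G x : convex_group G -> objective G x != -oo%E.
Proof.
move=> GC; rewrite /objective adde_eq_ninfty /= esum_eqNy.
apply/negP => /existsP[i /andP[_ /eqP h]].
by have := nonsmooth_neqNy (submxcol x i) GC; rewrite h.
Qed.

Lemma in_domain_of_lty G x : convex_group G -> in_feasible G x ->
  (objective G x < +oo)%E -> in_domain G x.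
Proof.
move=> GC xf; rewrite /objective => h i; split; first exact: xf.
apply: (@fin_num_of_sum_lty _ _ predT
  (fun i => nonsmooth_part G i (submxcol x i))) => //.
  by move=> j; apply: nonsmooth_neqNy.
by rewrite ltey; apply: contraTneq h => ->; rewrite addey // ltxx.
Qed.

Lemma block_domain_conv G i (v w : 'cV[R]_(p i)) (s : R) : convex_group G ->
  in_block_domain G v -> in_block_domain G w -> 0 <= s <= 1 ->
  in_block_domain G (s *: v + (1 - s) *: w)
  /\ fine (nonsmooth_part G i (s *: v + (1 - s) *: w))
     <= s * fine (nonsmooth_part G i v) + (1 - s) * fine (nonsmooth_part G i w).
Proof.
move=> GC [vf vd] [wf wd] s01; have [_ fc _ _ uc] := GC.
have [_ _ /(_ s v w s01) ucv] := uc i.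
have ux : (s%:E * nonsmooth_part G i v + (1 - s)%:E * nonsmooth_part G i w
   = (s * fine (nonsmooth_part G i v)
      + (1 - s) * fine (nonsmooth_part G i w))%:E)%E.
  by rewrite [RHS]EFinD !EFinM !fineK.
rewrite ux in ucv.
have ufin : nonsmooth_part G i (s *: v + (1 - s) *: w) \is a fin_num.
  by rewrite fin_numE nonsmooth_neqNy // lt_eqF // (le_lt_trans ucv) ?ltry.
split; last by rewrite -lee_fin fineK.
split => //; case/andP: s01 => s0 s1.
exact: (set_mem (fc i v w (Itv01 s0 s1) (mem_set vf) (mem_set wf))).
Qed.

Lemma in_domain_conv G x z (s : R) : convex_group G ->
  in_domain G x -> in_domain G z -> 0 <= s <= 1 ->
  in_domain G (s *: x + (1 - s) *: z)
  /\ forall i, nonsmooth_value G i (s *: x + (1 - s) *: z)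
     <= s * nonsmooth_value G i x + (1 - s) * nonsmooth_value G i z.
Proof.
move=> GC xd zd s01.
by split=> i; have [] := block_domain_conv GC (xd i) (zd i) s01;
   rewrite /nonsmooth_value submxcolD !submxcolZ.
Qed.

Lemma objective_value_conv G x z (s : R) : convex_group G ->
  in_domain G x -> in_domain G z -> 0 <= s <= 1 ->
  objective_value G (s *: x + (1 - s) *: z)
  <= s * objective_value G x + (1 - s) * objective_value G z.
Proof.
move=> GC xd zd s01; have [_ /(_ _) uc] := in_domain_conv GC xd zd s01.
have [_ _ _ fc _] := GC; have /andP[s0 s1] := s01.
have := fc (Itv01 s0 s1) x z; rewrite !in_setT => /(_ isT isT).
rewrite /conv /= /conv /= /unstable.onem /GRing.scale /= => fle.
rewrite /objective_value !mulrDr addrACA; apply: lerD => //.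
by rewrite !mulr_sumr -big_split /=; apply: ler_sum => i _; apply: uc.
Qed.

End Domain.

(** * Analysis of one block update *)

Section BlockStep.
Context {R : realType} {N : nat} {p : 'I_N -> nat} {l : nat}.
Variables (G : group R p l) (W : 'M[R]_(\sum_i p i)) (beta L : R) (n : nat).
Implicit Types (I : {set 'I_N}) (x z : 'cV[R]_(\sum_i p i)) (lam r : 'cV[R]_l).
Hypotheses (GC : convex_group G) (GL : lipschitz_partial_grad G n L).
Hypotheses (W_psd : psd W) (W_diag : block_diagonal W).

Local Notation A := (coupling G).
Local Notation gradG := (grad (smooth_part G)).

(** The summand - beta A^T A of the proximal matrix cancels the square of A d in the penalty; what
    remains is linear in [r] plus the form of the block diagonal [W]. *)
Lemma subproblemE I x lam r z :
  (forall i, i \in I -> nonsmooth_part G i (submxcol z i) \is a fin_num) ->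
  subproblem G W beta I x lam r z
  = (dot (gradG x - A^T *m lam) (restr I z)
     + beta * dot (A *m restr I (z - x)) r + beta / 2 * dot r r
     + 2^-1 * sqnorm W (restr I (z - x))
     + \sum_(i in I) nonsmooth_value G i z)%:E.
Proof.
move=> zd; rewrite /subproblem sum_nonsmoothE // -EFinD; congr (_%:E).
rewrite sqr_enorm sqnormDl sqnormNl sqnormZl sqnorm_gram !dotDl !dotDr.
by rewrite (dotC r (A *m _)); field.
Qed.

Lemma block_update_supp I x lam r x' :
  block_update G W beta I x lam r x' -> restr I (x' - x) = x' - x.
Proof.
case=> xI _ _; apply: restr_supp => i /xI h.
by rewrite submxcolB h subrr.
Qed.

(** The old point competes in the subproblem with a finite value, so the minimum is finite. *)
Lemma block_update_domain I x lam r x' : in_domain G x ->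
  block_update G W beta I x lam r x' -> in_domain G x'.
Proof.
move=> xd [xI xf xmin] i; have [iI|iI] := boolP (i \in I); last first.
  by rewrite /in_block_domain xI //; apply: xd.
split; first exact: xf.
have := xmin x (fun i _ => (xd i).1).
rewrite (@subproblemE I x lam r x) => [|j _]; last exact: (xd j).2.
rewrite /subproblem => h.
apply: (@fin_num_of_sum_lty _ _ (mem I)
  (fun i => nonsmooth_part G i (submxcol x' i))) => //.
  by move=> j; apply: nonsmooth_neqNy.
rewrite ltey; apply/negP => /eqP E.
by move: h; rewrite E addey // leye_eq.
Qed.

(* First-order optimality along the segment from [x'] to [z], on which the
   subproblem is a quadratic plus a convex function. *)
Lemma block_update_optimality I x lam r x' z :
  in_domain G x -> in_domain G z -> block_update G W beta I x lam r x' ->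
  0 <= dot (gradG x - A^T *m lam) (restr I (z - x'))
       + beta * dot (A *m restr I (z - x')) r
       + dot (restr I (z - x')) (W *m (x' - x))
       + \sum_(i in I) (nonsmooth_value G i z - nonsmooth_value G i x').
Proof.
move=> xd zd up; have x'd := block_update_domain xd up.
have D := block_update_supp up; have [_ _ xmin] := up.
apply: (@ge0_of_quadratic _ _ (2^-1 * sqnorm W (restr I (z - x')))).
move=> s /andP[s0 s1]; have s01 : 0 <= s <= 1 by rewrite ltW.
have [zsd zsu] := in_domain_conv GC zd x'd s01.
have := xmin _ (fun i _ => (zsd i).1).
rewrite !subproblemE => [|i _|i _]; last 2 first.
- exact: (zsd i).2.
- exact: (x'd i).2.
rewrite lee_fin; set e := restr I (z - x').
have Ez : restr I (s *: z + (1 - s) *: x') = restr I x' + s *: e.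
  rewrite /e -restrZ -restrD; congr (restr I _).
  by rewrite scalerBl scale1r scalerBr addrC addrAC addrA.
have Ed : restr I (s *: z + (1 - s) *: x' - x) = x' - x + s *: e.
  by rewrite restrB Ez addrAC -restrB D.
rewrite Ez Ed D.
have usum : \sum_(i in I) nonsmooth_value G i (s *: z + (1 - s) *: x')
  <= \sum_(i in I) nonsmooth_value G i x'
     + s * \sum_(i in I) (nonsmooth_value G i z - nonsmooth_value G i x').
  rewrite mulr_sumr -big_split /=; apply: ler_sum => i _.
  by apply: (le_trans (zsu i)); lra.
set Dx := x' - x; clearbody Dx.
rewrite !sqnormE !mulmxDr -!scalemxAr.
rewrite !(dotDl, dotDr, dotZl, dotZr).

rewrite (psd_dotC Dx e W_psd).
rewrite expr2; move: usum; lra.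
Qed.

(** The linear part is the gradient of the augmented Lagrangian with penalty [beta]. It is taken at
    the old point [x], so that it is fixed before the blocks are drawn. *)
Definition block_gap lam r xs x i : R :=
  dot (gradG x + A^T *m (beta *: r - lam)) (restr [set i] (x - xs))
  + (nonsmooth_value G i x - nonsmooth_value G i xs).

Lemma sum_block_gap lam r xs x I :
  \sum_(i in I) block_gap lam r xs x i
  = dot (gradG x + A^T *m (beta *: r - lam)) (restr I (x - xs))
    + \sum_(i in I) (nonsmooth_value G i x - nonsmooth_value G i xs).
Proof. by rewrite big_split /= restr_sum dot_sumr. Qed.

Lemma sum_block_gap_ge lam r xs x :
  objective_value G x - objective_value G xs
  + dot (beta *: r - lam) (A *m (x - xs))
  <= \sum_i block_gap lam r xs x i.
Proof.
have -> : \sum_i block_gap lam r xs x i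
  = \sum_(i in [set: 'I_N]) block_gap lam r xs x i.
  by apply: eq_bigl => i; rewrite finset.in_setT.
rewrite sum_block_gap restrT dotDl dot_trmx.
have [_ _ df cf _] := GC.
have := convex_grad_le df x xs cf; rewrite -opprB dotNr.
have -> : \sum_(i in [set: 'I_N])
    (nonsmooth_value G i x - nonsmooth_value G i xs)
  = \sum_i nonsmooth_value G i x - \sum_i nonsmooth_value G i xs.
  by rewrite -sumrB; apply: eq_bigl => i; rewrite finset.in_setT.
rewrite /objective_value; lra.
Qed.

(** Optimality tested at [xs] controls the gap at [x']. Splitting x' - xs into x - xs and x' - x
    moves it to [x]; the gradient term along x' - x is paid by the descent lemma, and the one along
    A (x' - x) stays. *)
Lemma block_step I x lam r x' xs : #|I| = n ->
  in_domain G x -> in_domain G xs -> block_update G W beta I x lam r x' ->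
  objective_value G x' - objective_value G x
  + \sum_(i in I) block_gap lam r xs x i
  + dot (beta *: r - lam) (A *m (x' - x))
  + 2^-1 * (sqnorm W (x' - xs) - sqnorm W (x - xs)
            + (sqnorm W (x' - x) - L * dot (x' - x) (x' - x))) <= 0.
Proof.
move=> cI xd xsd up; have D := block_update_supp up.
have opt := block_update_optimality xd xsd up; have [xI _ _] := up.
have [_ _ df _ _] := GC.
have := restr_descent x df GL cI D; rewrite addrC subrK => desc.
have objE : objective_value G x' - objective_value G x
    = smooth_part G x' - smooth_part G x
      + \sum_(i in I) (nonsmooth_value G i x' - nonsmooth_value G i x).
  rewrite /objective_value opprD addrACA; congr (_ + _).
  rewrite -sumrB (bigID (mem I)) /= [X in _ + X]big1 ?addr0 //.
  by move=> i /xI h; rewrite /nonsmooth_value h subrr.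
(* A block diagonal [W] commutes with [restr I], which fixes x' - x. With the three-point identity
   [Wx], this becomes a difference of squared distances to [xs]. *)
have WD : dot (restr I (xs - x')) (W *m (x' - x))
    = - dot (x' - xs) (W *m (x' - x)).
  by rewrite dot_restr -mulmx_restr_diag // D -opprB dotNl.
have Wx : sqnorm W (x - xs) = sqnorm W (x' - xs)
    - 2 * dot (x' - xs) (W *m (x' - x)) + sqnorm W (x' - x).
  have -> : x - xs = (x' - xs) - (x' - x).
    by rewrite opprB [RHS]addrC addrA subrK.
  move: (x' - xs) (x' - x) => u v.
  rewrite !sqnormE mulmxDr mulmxN !(dotDl, dotDr, dotNl, dotNr).
  by rewrite (psd_dotC v u W_psd); ring.
have eE : restr I (xs - x') = - restr I (x - xs) - (x' - x).
  rewrite -D -restrN -restrB; congr (restr I _).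
  by rewrite !opprB addrA subrK.
move: opt; rewrite WD eE sum_block_gap objE Wx !sumrB.
move: desc; set Dx := x' - x; set h := restr I (x - xs); set d := x' - xs.
clearbody Dx h d => desc.
rewrite !(mulmxDr, mulmxN) !(dotDl, dotDr, dotNl, dotNr, dotZl) !dot_trmx.
rewrite !(dotDl, dotDr, dotNl, dotNr, dotZl) !(dotC r).
by move: desc; lra.
Qed.

End BlockStep.

(** * Weighted averages and the multiplier potential *)

(** Jensen's inequality by induction: the last point, of weight 1, is generalized to a fixed [z],
    and each step appends a point of weight [theta]. *)
Lemma weighted_average_objective {R : realType} {N : nat} {p : 'I_N -> nat}
    {l : nat} (G : group R p l) (theta : R) (t : nat)
    (x : nat -> 'cV[R]_(\sum_i p i)) :
  convex_group G -> 0 <= theta -> (forall k, in_domain G (x k)) ->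
  in_domain G (weighted_average theta t x)
  /\ (1 + theta * t%:R) * objective_value G (weighted_average theta t x)
     <= objective_value G (x t.+1)
        + theta * \sum_(1 <= k < t.+1) objective_value G (x k).
Proof.
move=> GC th0 xd; rewrite /weighted_average; set z := x t.+1.
have : in_domain G z by apply: xd.
move: z => z zd; elim: t => [|t [IHd IHo]].
  rewrite big_geq // scaler0 addr0 mulr0 addr0 invr1 scale1r mul1r.
  by rewrite big_geq // mulr0 addr0.
rewrite !(big_nat_recr t.+1) //=.
set S := \sum_(1 <= k < t.+1) x k in IHd IHo *.
set w := 1 + theta * t%:R in IHd IHo *.
have w0 : 0 < w by rewrite ltr_wpDr ?mulr_ge0 ?ler0n.
have -> : 1 + theta * t.+1%:R = w + theta by rewrite /w -natr1; ring.
have wt0 : 0 < w + theta by rewrite ltr_wpDr.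
pose s := w / (w + theta).
have s01 : 0 <= s <= 1.
  by rewrite divr_ge0 ?(ltW w0) ?(ltW wt0) //= ler_pdivrMr // mul1r lerDl.
have s1 : 1 - s = theta / (w + theta).
  by rewrite /s; field; rewrite gt_eqF.
have E : (w + theta)^-1 *: (z + theta *: (S + x t.+1))
    = s *: (w^-1 *: (z + theta *: S)) + (1 - s) *: x t.+1.
  have sw : s / w = (w + theta)^-1 by rewrite /s; field; rewrite !gt_eqF.
  rewrite s1 scalerA sw (mulrC theta) -scalerA.
  by rewrite -scalerDr -[_ + _ + _ *: x t.+1]addrA -scalerDr.
have [d _] := in_domain_conv GC IHd (xd t.+1) s01.
have := objective_value_conv GC IHd (xd t.+1) s01.
rewrite -E in d *; move=> o; split => //.
have := ler_wpM2l (ltW wt0) o.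
have -> a b : (w + theta) * (s * a + (1 - s) * b) = w * a + theta * b.
  by rewrite s1 /s; field; rewrite gt_eqF.
by move/le_trans; apply; move: IHo; lra.
Qed.

(** Used with e = mu - lam. At theta = 1 only the classical |e|^2 / (2 beta) is left. *)
Definition potential {R : realType} {l : nat} (theta beta : R)
    (e r : 'cV[R]_l) : R :=
  (1 - theta) * dot e r + (2 * beta)^-1 * dot e e
  + beta * (1 - theta) / 2 * dot r r.

(** Completing the square: it equals |e + beta (1 - theta) r|^2 / (2 beta) + beta theta (1 - theta)
    |r|^2 / 2. *)
Lemma potential_ge0 {R : realType} {l : nat} (theta beta : R)
    (e r : 'cV[R]_l) :
  0 < beta -> 0 <= theta <= 1 -> 0 <= potential theta beta e r.
Proof.
move=> b0 /andP[th0 th1].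
have b20 : 0 < (2 * beta)^-1 by rewrite invr_gt0 mulr_gt0.
have := mulr_ge0 (ltW b20) (dotvv_ge0 (e + (beta * (1 - theta)) *: r)).
have := mulr_ge0 (mulr_ge0 (ltW b0) (mulr_ge0 th0 _)) (dotvv_ge0 r).
move/(_ (1 - theta)); rewrite subr_ge0 => /(_ th1).
rewrite !(dotDl, dotDr, dotZl, dotZr) (dotC r e).
have -> : (2 * beta)^-1 * (dot e e + beta * (1 - theta) * dot e r
     + (beta * (1 - theta) * dot e r
        + beta * (1 - theta) * (beta * (1 - theta) * dot r r)))
  = (2 * beta)^-1 * dot e e + (1 - theta) * dot e r
    + beta * (1 - theta) / 2 * dot r r
    - (beta * (theta * (1 - theta)) * dot r r) / 2.
  by field; rewrite gt_eqF.
rewrite /potential; lra.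
Qed.

(* The slack of this inequality is exactly
   [beta / 2 * |theta (a + c + u) - (1 - theta) v|^2]. *)
Lemma potential_step {R : realType} {l : nat} (theta beta : R)
    (a c u v e : 'cV[R]_l) : 0 < beta ->
  let r := a + c in let r' := r + u + v in
  potential theta beta (e + (theta * beta) *: r') r' - potential theta beta e r
  <= dot (e + beta *: r) (r' - (1 - theta) *: r) + theta * beta * dot u c
     + beta * dot u v
     + theta * beta / 2 * (dot (a + u) (a + u) - dot a a)
     + beta / 2 * dot u u + (2 - theta) * beta / 2 * dot v v.
Proof.
move=> b0 /=; rewrite -subr_ge0.
have := mulr_ge0 (divr_ge0 (ltW b0) (ler0n R 2))
  (dotvv_ge0 (theta *: (a + c + u) - (1 - theta) *: v)).
congr (0 <= _); rewrite /potential.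
rewrite !(dotDl, dotDr, dotZl, dotZr, dotNl, dotNr).
rewrite (dotC c a) (dotC u a) (dotC v a) (dotC e a) (dotC u c) (dotC v c).
rewrite (dotC e c) (dotC v u) (dotC e u) (dotC e v).
by field; rewrite gt_eqF.
Qed.

Definition draw_excess {R : realType} {N : nat} (theta : R) (I : {set 'I_N})
    (g : 'I_N -> R) : R :=
  \sum_(i in I) g i - theta * \sum_i g i.

(** * Deterministic estimates along one sample path *)

Section Path.
Context {R : realType} {N M : nat} {p : 'I_N -> nat} {q : 'I_M -> nat}.
Context {l : nat}.
Variables (GX : group R p l) (GY : group R q l) (b : 'cV[R]_l).
Variables (P : 'M[R]_(\sum_i p i)) (Q : 'M[R]_(\sum_j q j)).
Variables (n m : nat) (Lf Lg beta theta : R).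
Variables (I : nat -> {set 'I_N}) (J : nat -> {set 'I_M}).
Variables (x : nat -> 'cV[R]_(\sum_i p i)) (y : nat -> 'cV[R]_(\sum_j q j)).
Variables (lam r : nat -> 'cV[R]_l).
Variables (xs : 'cV[R]_(\sum_i p i)) (ys : 'cV[R]_(\sum_j q j)).

Local Notation A := (coupling GX).
Local Notation B := (coupling GY).
Local Notation res := (residual GX GY b).
Local Notation r_half k := (r k + A *m restr (I k) (x k.+1 - x k)).

Hypotheses (GXC : convex_group GX) (GYC : convex_group GY).
Hypotheses (GXL : lipschitz_partial_grad GX n Lf).
Hypotheses (GYL : lipschitz_partial_grad GY m Lg).
Hypotheses (P_psd : psd P) (P_diag : block_diagonal P).
Hypotheses (Q_psd : psd Q) (Q_diag : block_diagonal Q).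
Hypotheses (beta_gt0 : 0 < beta) (theta01 : 0 <= theta <= 1).
(** The constants here and in [Q_draw] are twice the coefficients of |u|^2 and |v|^2 in
    [potential_step], where u = A (x' - x) and v = B (y' - y). *)
Hypothesis P_draw : forall (D : {set 'I_N}) z, #|D| = n -> restr D z = z ->
  beta * dot (A *m z) (A *m z) <= sqnorm P z - Lf * dot z z.
Hypothesis Q_draw : forall (D : {set 'I_M}) z, #|D| = m -> restr D z = z ->
  (2 - theta) * beta * dot (B *m z) (B *m z) <= sqnorm Q z - Lg * dot z z.
Hypothesis P_full : forall z,
  theta * beta * dot (A *m z) (A *m z) <= sqnorm P z.
Hypotheses (x0d : in_domain GX (x 0%N)) (y0d : in_domain GY (y 0%N)).
Hypotheses (xsd : in_domain GX xs) (ysd : in_domain GY ys).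
Hypotheses (r0E : r 0%N = res (x 0%N) (y 0%N)) (res_s : res xs ys = 0).
Hypotheses (cI : forall k, #|I k| = n) (cJ : forall k, #|J k| = m).
Hypothesis x_up : forall k,
  block_update GX P beta (I k) (x k) (lam k) (r k) (x k.+1).
Hypothesis y_up : forall k,
  block_update GY Q beta (J k) (y k) (lam k) (r_half k) (y k.+1).
Hypothesis rE : forall k,
  r k.+1 = r_half k + B *m restr (J k) (y k.+1 - y k).
Hypothesis lamE : forall k, lam k.+1 = lam k - (theta * beta) *: r k.+1.

Lemma path_in_domain_x k : in_domain GX (x k).
Proof. by elim: k => // k IH; apply: block_update_domain IH (x_up k). Qed.

Lemma path_in_domain_y k : in_domain GY (y k).
Proof. by elim: k => // k IH; apply: block_update_domain IH (y_up k). Qed.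

Lemma path_half k : r_half k = r k + A *m (x k.+1 - x k).
Proof. by rewrite (block_update_supp (x_up k)). Qed.

Lemma path_residual k : r k = res (x k) (y k).
Proof.
elim: k => // k IH; rewrite rE path_half (block_update_supp (y_up k)) IH.
rewrite /residual !mulmxBr.
by apply/colP => i; rewrite !mxE; ring.
Qed.

Lemma path_residual_split k : r k = A *m (x k - xs) + B *m (y k - ys).
Proof.
rewrite path_residual -[LHS]subr0 -res_s /residual !mulmxBr.
by apply/colP => i; rewrite !mxE; ring.
Qed.

Definition gap_value k : R :=
  objective_value GX (x k) + objective_value GY (y k)
  - (objective_value GX xs + objective_value GY ys).

(** The subtracted square of A (x - xs) is the telescoping term |a + u|^2 - |a|^2 of
    [potential_step]; it turns [P] into the matrix P tilde of the final bound. *)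
Definition lyapunov (mu : 'cV[R]_l) k : R :=
  2^-1 * (sqnorm P (x k - xs)
          - theta * beta * dot (A *m (x k - xs)) (A *m (x k - xs)))
  + 2^-1 * sqnorm Q (y k - ys) + potential theta beta (mu - lam k) (r k).

(** The second gap is evaluated at the half-step residual and thus depends on [I k], but not on
    [J k]. *)
Definition excess k : R :=
  draw_excess theta (I k) (block_gap GX beta (lam k) (r k) xs (x k))
  + draw_excess theta (J k) (block_gap GY beta (lam k) (r_half k) ys (y k)).

Lemma lyapunov_ge0 mu k : 0 <= lyapunov mu k.
Proof.
have Qge := Q_psd.2 (y k - ys); have Pge := P_full (x k - xs).
have pge := potential_ge0 (mu - lam k) (r k) beta_gt0 theta01.
by rewrite /lyapunov; lra.
Qed.

(** The decrease F(x') - F(x) plus theta times the gap at [x] is the new gap minus 1 - theta times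
    the old one. The residual products regroup in the same way into <beta r - lam, r' - (1 - theta)
    r>, and the half-step residual adds theta beta <u, c> + beta <u, v>. *)
Lemma path_step mu k :
  (gap_value k.+1 - dot mu (r k.+1)) - (1 - theta) * (gap_value k - dot mu (r k))
  + excess k + lyapunov mu k.+1 - lyapunov mu k <= 0.
Proof.
have /andP[th0 th1] := theta01.
have := block_step GXC GXL P_psd P_diag (cI k) (path_in_domain_x k) xsd (x_up k).
have := block_step GYC GYL Q_psd Q_diag (cJ k) (path_in_domain_y k) ysd (y_up k).
have Dx := block_update_supp (x_up k); have Dy := block_update_supp (y_up k).
have := P_draw (cI k) Dx; have := Q_draw (cJ k) Dy.
have := sum_block_gap_ge beta GXC (lam k) (r k) xs (x k).
have := sum_block_gap_ge beta GYC (lam k) (r_half k) ys (y k).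
rewrite /gap_value /excess /draw_excess /lyapunov.
set gX := \sum_i block_gap GX _ _ _ _ _ _.
set gY := \sum_i block_gap GY _ _ _ _ _ _.
set gXI := \sum_(i in I k) _; set gYJ := \sum_(i in J k) _.
clearbody gX gY gXI gYJ.
rewrite rE lamE rE path_half Dy.
have rk := path_residual_split k.
have dAx : A *m (x k.+1 - xs) = A *m (x k - xs) + A *m (x k.+1 - x k).
  by rewrite -mulmxDr; congr (_ *m _); apply/colP => i; rewrite !mxE; ring.
rewrite dAx rk.
set a := A *m (x k - xs); set c := B *m (y k - ys).
set u := A *m (x k.+1 - x k); set v := B *m (y k.+1 - y k).
have /= := potential_step theta a c u v (mu - lam k) beta_gt0.
have -> : mu - (lam k - (theta * beta) *: (a + c + u + v))
   = mu - lam k + (theta * beta) *: (a + c + u + v).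
  by rewrite opprB addrA addrAC.
set pot1 := potential _ _ _ (a + c + u + v); set pot0 := potential _ _ _ (a + c).
clearbody pot1 pot0 a c u v.
set s1 := sqnorm P (x k.+1 - xs); set s2 := sqnorm P (x k - xs).
set s3 := sqnorm P _; set s4 := sqnorm Q (y k.+1 - ys).
set s5 := sqnorm Q (y k - ys); set s6 := sqnorm Q _.
set d1 := dot (x k.+1 - x k) _; set d2 := dot (y k.+1 - y k) _.
clearbody s1 s2 s3 s4 s5 s6 d1 d2.
rewrite !(dotDl, dotDr, dotZl, dotZr, dotNl, dotNr).
rewrite ?(dotC c a) ?(dotC u a) ?(dotC v a) ?(dotC u c) ?(dotC v c) ?(dotC v u).
move=> pot gy gx Qd Pd sy sx.
(* The full gap sums enter [excess] with weight [theta]; what remains is linear. *)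
have gx1 := ler_wpM2l th0 gx; have gy1 := ler_wpM2l th0 gy.
lra.
Qed.

(** Passing the share 1 - theta on to the next step leaves weight [theta] on steps 1 to t and weight
    1 on the last: the weights of [weighted_average]. *)
Lemma path_sum mu t :
  (gap_value t.+1 - dot mu (r t.+1))
  + theta * \sum_(1 <= k < t.+1) (gap_value k - dot mu (r k))
  + \sum_(k < t.+1) excess k + lyapunov mu t.+1
  <= (1 - theta) * (gap_value 0 - dot mu (r 0%N)) + lyapunov mu 0.
Proof.
elim: t => [|t IH].
  rewrite big_geq // big_ord1 mulr0 addr0.
  by have := path_step mu 0; lra.
rewrite (big_nat_recr t.+1) //= big_ord_recr /= mulrDr.
by have := path_step mu t.+1; lra.
Qed.

Lemma path_residual_average t :
  (1 + theta * t%:R) *: res (weighted_average theta t x) (weighted_average theta t y)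
  = r t.+1 + theta *: \sum_(1 <= k < t.+1) r k.
Proof.
have /andP[th0 _] := theta01.
have w0 : 1 + theta * t%:R != 0.
  by rewrite gt_eqF // ltr_wpDr // mulr_ge0 // ler0n.
have -> : \sum_(1 <= k < t.+1) r k
  = A *m (\sum_(1 <= k < t.+1) x k) + B *m (\sum_(1 <= k < t.+1) y k) - t%:R *: b.
  elim: t {w0} => [|t IH].
    by rewrite !big_geq // !mulmx0 scale0r subr0 addr0.
  rewrite !(big_nat_recr t.+1) //= IH path_residual /residual !mulmxDr -natr1.
  by apply/colP => i; rewrite !mxE; ring.
rewrite path_residual /residual /weighted_average -!scalemxAr !mulmxDr -!scalemxAr.
rewrite scalerDr scalerDr !scalerA mulfV // !scale1r.
by apply/colP => i; rewrite !mxE; ring.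
Qed.

Lemma path_bound gamma t : 0 <= gamma -> lam 0%N = 0 ->
  let xh := weighted_average theta t x in
  let yh := weighted_average theta t y in
  (1 + theta * t%:R) * (objective_value GX xh + objective_value GY yh
     - (objective_value GX xs + objective_value GY ys)
     + gamma * enorm (res xh yh)) + \sum_(k < t.+1) excess k
  <= (1 - theta) * (gap_value 0 + beta * dot (r 0%N) (r 0%N))
     + 2^-1 * (sqnorm P (x 0%N - xs)
          - theta * beta * dot (A *m (x 0%N - xs)) (A *m (x 0%N - xs)))
     + 2^-1 * sqnorm Q (y 0%N - ys) + gamma ^+ 2 / (2 * beta).
Proof.
move=> g0 lam0 /=; set xh := weighted_average theta t x.
set yh := weighted_average theta t y; set rh := res xh yh.
have /andP[th0 th1] := theta01.
have [_] := weighted_average_objective t GXC th0 path_in_domain_x.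
have [_] := weighted_average_objective t GYC th0 path_in_domain_y.
rewrite -/xh -/yh => yo xo.
(* The vector of norm [gamma] that maximizes - <mu, rh>. If [rh = 0], division by zero yields
   [mu = 0], and both facts below persist. *)
pose mu := - ((gamma / enorm rh) *: rh).
have mur : dot mu rh = - (gamma * enorm rh).
  rewrite /mu dotNl dotZl -sqr_enorm; congr (- _).
  by have [->|h] := eqVneq (enorm rh) 0; [rewrite invr0; ring | field].
have mumu : dot mu mu <= gamma ^+ 2.
  rewrite /mu dotNl dotNr opprK dotZl dotZr -sqr_enorm.
  have [->|h] := eqVneq (enorm rh) 0.
    by rewrite expr0n /= !mulr0 sqr_ge0.
  by rewrite le_eqVlt; apply/orP; left; apply/eqP; field.
have := path_sum mu t; have := lyapunov_ge0 mu t.+1.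
have avg : (1 + theta * t%:R) * dot mu rh
    = dot mu (r t.+1) + theta * \sum_(1 <= k < t.+1) dot mu (r k).
  rewrite -dotZr path_residual_average dotDr dotZr dot_sumr //.
have gsum : \sum_(1 <= k < t.+1) gap_value k
    = \sum_(1 <= k < t.+1) objective_value GX (x k)
      + \sum_(1 <= k < t.+1) objective_value GY (y k)
      - t%:R * (objective_value GX xs + objective_value GY ys).
  rewrite /gap_value sumrB big_split /= sumr_const_nat subn1 /=.
  by rewrite mulr_natl.
rewrite sumrB gsum => lge psum.
have b2 : 0 <= (2 * beta)^-1 by rewrite invr_ge0 mulr_ge0 // ltW.
have := ler_wpM2r b2 mumu.
have rr : 0 <= beta * (1 - theta) * dot (r 0%N) (r 0%N).
  by rewrite !mulr_ge0 ?dotvv_ge0 ?subr_ge0 // ltW.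
(* At [lam 0 = 0] the cross term of [potential] cancels (1 - theta) <mu, r 0>, so [mu] survives only
   through its square; [rr] rounds half of the squared initial residual up to the whole. *)
move: psum; rewrite {2}/lyapunov /potential lam0 subr0 /gap_value.
move: avg; rewrite mur.
lra.
Qed.

End Path.

Local Open Scope classical_set_scope.

(** * Expectations of variables with finitely many values *)

Section FiniteMean.
Context {R : realType} {d : measure_display} {T : measurableType d}.
Variable Pr : probability T R.

Definition fmean (F : finType) (v : T -> F) (phi : F -> R) : R :=
  \sum_s phi s * fine (Pr [set w | v w = s]).

Section OneVariable.
Context {F : finType}.
Variable v : T -> F.
Hypothesis mv : forall s, measurable [set w | v w = s].

Lemma integral_fmean (phi : F -> R) :
  (\int[Pr]_w (phi (v w))%:E = (fmean v phi)%:E)%E.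
Proof.
have phiE w : (phi (v w))%:E
    = (\sum_s (phi s)%:E * (\1_[set w | v w = s] w)%:E)%E.
  rewrite (bigD1 (v w)) //= big1 ?adde0 => [|s sv].
    by rewrite indicE mem_set // mule1.
  rewrite indicE memNset ?mule0 //= => vs.
  by rewrite vs eqxx in sv.
under eq_integral do rewrite phiE.
rewrite integral_sum //= => [|s]; last first.
  by apply: integrableZl => //; apply: integrable_indic.
rewrite /fmean -sumEFin; apply: eq_bigr => s _.
rewrite integralZl //; last exact: integrable_indic.
by rewrite integral_indic // setIT EFinM fineK // fin_num_measure.
Qed.

Lemma fmean_cst (c : R) : fmean v (fun=> c) = c.
Proof.
apply: EFin_inj; rewrite -integral_fmean.
rewrite (integral_cst _ measurableT) -[RHS]mule1.
by congr (_ * _)%E; apply: probability_setT.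
Qed.

(** Values that [v] never takes have an empty event, so a comparison along sample points
    suffices. *)
Lemma fmean_le (phi psi : F -> R) :
  (forall w, phi (v w) <= psi (v w)) -> fmean v phi <= fmean v psi.
Proof.
move=> h; apply: ler_sum => s _.
have [[w ws]|/forallNP vs] := pselect (exists w, v w = s).
  by rewrite ler_wpM2r ?fine_ge0 // -ws.
have -> : [set w | v w = s] = set0 by apply/seteqP; split => // w /vs.
by rewrite measure0 !mulr0.
Qed.

Lemma fmeanD (phi psi : F -> R) :
  fmean v (fun s => phi s + psi s) = fmean v phi + fmean v psi.
Proof. by rewrite -big_split; apply: eq_bigr => s _; rewrite mulrDl. Qed.

Lemma fmeanZ (c : R) (phi : F -> R) :
  fmean v (fun s => c * phi s) = c * fmean v phi.
Proof. by rewrite mulr_sumr; apply: eq_bigr => s _; rewrite mulrA. Qed.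

Lemma fmean_sum (K : Type) (r : seq K) (phi : K -> F -> R) :
  fmean v (fun s => \sum_(k <- r) phi k s) = \sum_(k <- r) fmean v (phi k).
Proof.
rewrite exchange_big; apply: eq_bigr => s _ /=.
by rewrite mulr_suml.
Qed.

End OneVariable.

(** Both sides are the integral of one random variable. This carries a mean from the draws up to
    step k over to a longer history. *)
Lemma fmean_factor (F F' : finType) (v : T -> F) (v' : T -> F')
    (phi : F -> R) (phi' : F' -> R) :
  (forall s, measurable [set w | v w = s]) ->
  (forall s, measurable [set w | v' w = s]) ->
  (forall w, phi (v w) = phi' (v' w)) -> fmean v phi = fmean v' phi'.
Proof.
move=> mv mv' E; apply: EFin_inj; rewrite -!integral_fmean //.
by under eq_integral do rewrite E.
Qed.

Lemma measurable_pair_event (F F' : finType) (v : T -> F) (v' : T -> F') :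
  (forall s, measurable [set w | v w = s]) ->
  (forall s, measurable [set w | v' w = s]) ->
  forall s, measurable [set w | (v w, v' w) = s].
Proof.
move=> mv mv' [s s'].
have -> : [set w | (v w, v' w) = (s, s')]
    = [set w | v w = s] `&` [set w | v' w = s'].
  by apply/seteqP; split => w /= [-> ->].
exact: measurableI.
Qed.

Lemma sum_draw_prob (N n : nat) (D : T -> {set 'I_N}) :
  (0 < n <= N)%N -> (forall w, #|D w| = n) ->
  (forall S : {set 'I_N}, #|S| = n ->
     Pr [set w | D w = S] = ('C(N, n)%:R^-1)%:E) ->
  forall i : 'I_N,
  \sum_(S : {set 'I_N} | i \in S) fine (Pr [set w | D w = S]) = n%:R / N%:R.
Proof.
move=> /andP[n0 nN] cD DP i.
have pS (S : {set 'I_N}) : fine (Pr [set w | D w = S])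
    = if #|S| == n then ('C(N, n))%:R^-1 else 0.
  case: eqP => [/DP -> //|cS].
  have -> : [set w | D w = S] = set0.
    by apply/seteqP; split => // w /= DS; apply: cS; rewrite -DS.
  by rewrite measure0.
under eq_bigr do rewrite pS.
rewrite -big_mkcondr /= sumr_const.
case: n n0 nN {cD DP pS} => // n _ nN; have := card_draws_mem n i.
set c := #|_|; set c' := #|_|; have -> : c' = c.
  by apply: eq_card => S; rewrite finset.inE andbC.
move/(congr1 (fun k => k%:R : R)); rewrite !natrM => E.
have C0 : ('C(N, n.+1))%:R != 0 :> R by rewrite pnatr_eq0 -lt0n bin_gt0.
have N0 : N%:R != 0 :> R by rewrite pnatr_eq0 -lt0n (leq_trans _ nN).
have cE : c%:R = n.+1%:R * ('C(N, n.+1))%:R / N%:R :> R.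
  by rewrite -E mulrAC mulfV ?mul1r.
by rewrite -[LHS]mulr_natr cE; field; rewrite C0 N0.
Qed.

(** Given v = s the coefficients [g s] are fixed and, by independence, the law of [D] is unchanged;
    each block is then drawn with probability n / N. *)
Lemma fmean_draw_excess (N n : nat) (D : T -> {set 'I_N}) (F : finType)
    (v : T -> F) (g : F -> 'I_N -> R) :
  (0 < n <= N)%N -> (forall w, #|D w| = n) ->
  (forall S, measurable [set w | D w = S]) ->
  (forall S : {set 'I_N}, #|S| = n ->
     Pr [set w | D w = S] = ('C(N, n)%:R^-1)%:E) ->
  (forall s S, Pr ([set w | v w = s] `&` [set w | D w = S])
     = (Pr [set w | v w = s] * Pr [set w | D w = S])%E) ->
  (forall s, measurable [set w | v w = s]) ->
  fmean (fun w => (v w, D w))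
    (fun sS => draw_excess (n%:R / N%:R) sS.2 (g sS.1)) = 0.
Proof.
move=> nN cD mD DP ind mv; set theta := n%:R / N%:R.
have pDv s S : fine (Pr [set w | (v w, D w) = (s, S)])
    = fine (Pr [set w | v w = s]) * fine (Pr [set w | D w = S]).
  have -> : [set w | (v w, D w) = (s, S)]
      = [set w | v w = s] `&` [set w | D w = S].
    by apply/seteqP; split => w /= [-> ->].
  by rewrite ind fineM // fin_num_measure.
rewrite /fmean.
transitivity (\sum_s \sum_S draw_excess theta S (g s)
  * fine (Pr [set w | (v w, D w) = (s, S)])).
  by rewrite pair_bigA; apply: eq_bigr => -[s S] _.
rewrite big1 // => s _; under eq_bigr do rewrite pDv mulrCA.
rewrite -mulr_sumr; apply/eqP; rewrite mulf_eq0; apply/orP; right; apply/eqP.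
under eq_bigr do rewrite mulrBl.
rewrite sumrB -mulr_sumr.
have -> : \sum_S fine (Pr [set w | D w = S]) = 1.
  by rewrite -(fmean_cst mD 1); apply: eq_bigr => S _; rewrite mul1r.
rewrite mulr1; under eq_bigr do rewrite mulr_suml.
rewrite (exchange_big_dep xpredT) //= mulr_sumr; apply/eqP.
rewrite subr_eq0; apply/eqP; apply: eq_bigr => i _.
rewrite -mulr_sumr (sum_draw_prob nN cD DP) mulrC //.
Qed.

End FiniteMean.

(** [phi] evaluates [Z] at a chosen preimage; [x0] fills in outside the range of [v]. *)
Lemma factor_through (T F X : Type) (x0 : X) (v : T -> F) (Z : T -> X) :
  (forall w w', v w = v w' -> Z w = Z w') ->
  exists phi : F -> X, forall w, Z w = phi (v w).
Proof.
move=> h; exists (fun s => if pselect (exists w, v w = s) is left e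
  then Z (projT1 (cid e)) else x0) => w.
case: pselect => [e|[]]; last by exists w.
by apply: h; rewrite (projT2 (cid e)).
Qed.

(** * The finite history of draws *)

Section History.
Context {R : realType} {d : measure_display} {T : measurableType d}.
Context {N M : nat}.
Variables (Pr : probability T R) (n m : nat).
Variables (I : nat -> T -> {set 'I_N}) (J : nat -> T -> {set 'I_M}).
Hypotheses (nN : (0 < n <= N)%N) (mM : (0 < m <= M)%N).
Hypothesis draws : uniform_draws I J Pr n m.

Definition history k (w : T) : {ffun 'I_k -> {set 'I_N} * {set 'I_M}} :=
  [ffun j : 'I_k => (I j w, J j w)].

Lemma history_eqP k w w' :
  history k w = history k w' <-> same_draws_before I J k w w'.
Proof.
split=> [/ffunP h j jk|h].
  by have := h (Ordinal jk); rewrite !ffunE => -[].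
by apply/ffunP => j; rewrite !ffunE; have [-> ->] := h j (ltn_ord j).
Qed.

Lemma history_event k s : exists S V,
  [set w | history k w = s] = drawn_before I J k S V.
Proof.
(* Indices from [k] on get the empty set, which [drawn_before] at [k] never inspects. *)
pose S j := if insub j is Some i then (s i).1 else finset.set0.
pose V j := if insub j is Some i then (s i).2 else finset.set0.
exists S, V; apply/seteqP; split => w /=.
  by move=> E j jk; rewrite /S /V insubT /= -E ffunE.
move=> h; apply/ffunP => j; rewrite ffunE; have := h j (ltn_ord j).
by rewrite /S /V valK => -[-> ->]; case: (s j).
Qed.

Lemma measurable_drawn_before k S V : measurable (drawn_before I J k S V).
Proof.
have [_ mIJ _ _ _] := draws.
elim: k => [|k IH].
  have -> : drawn_before I J 0 S V = setT by apply/seteqP; split.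
  exact: measurableT.
have -> : drawn_before I J k.+1 S V = drawn_before I J k S V
    `&` [set w | I k w = S k] `&` [set w | J k w = V k].
  apply/seteqP; split => w /=.
    move=> h; split; last by case: (h k (ltnSn k)).
    by split; [move=> j jk; apply: h; exact: ltnW | case: (h k (ltnSn k))].
  move=> [[h Ik] Jk] j; rewrite ltnS leq_eqVlt => /predU1P[->|/h] //.
have [mI mJ] := mIJ k (S k) (V k).
by apply: measurableI => //; apply: measurableI.
Qed.

Lemma measurable_history k s : measurable [set w | history k w = s].
Proof.
by have [S [V ->]] := history_event s; apply: measurable_drawn_before.
Qed.

Lemma measurable_draw_x k S : measurable [set w | I k w = S].
Proof. by have [_ /(_ k S finset.set0) [? _] _ _ _] := draws. Qed.

Lemma measurable_draw_y k V : measurable [set w | J k w = V].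
Proof. by have [_ /(_ k finset.set0 V) [_ ?] _ _ _] := draws. Qed.

(** The mean is computed on the history before [k] paired with [I k], but [phi] lives on a horizon
    [t] common to all steps, so that the excess terms can be added. *)
Lemma fmean_excess_x k t (g : T -> 'I_N -> R) : (k < t)%N ->
  (forall w w', history k w = history k w' -> g w = g w') ->
  exists2 phi, forall w,
    draw_excess (n%:R / N%:R) (I k w) (g w) = phi (history t w)
    & fmean Pr (history t) phi = 0.
Proof.
move=> kt gh; have [c _ DP ind _] := draws.
have [f fE] := factor_through (fun=> 0) gh.
exists (fun s : {ffun 'I_t -> _} => draw_excess (n%:R / N%:R)
  (s (Ordinal kt)).1 (f [ffun j : 'I_k => s (widen_ord (ltnW kt) j)])).
  move=> w; rewrite fE ffunE /=; congr (draw_excess _ _ (f _)).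
  by apply/ffunP => j; rewrite !ffunE.
have mv := @measurable_history k.
rewrite -(fmean_draw_excess (Pr := Pr) (D := I k) (v := history k) f nN _
  (measurable_draw_x k) _ _ mv).
- apply: fmean_factor => [s||w].
  + exact: measurable_history.
  + exact: measurable_pair_event mv (measurable_draw_x k).
  + rewrite ffunE /=; congr (draw_excess _ _ (f _)).
    by apply/ffunP => j; rewrite !ffunE.
- by move=> w; case: (c k w).
- by move=> S cS; have [/(_ cS)] := DP k S finset.set0.
- by move=> s S; have [S' [V' ->]] := history_event s; apply: ind.
Qed.

(** Here the past includes [I k], matching the half-step residual; the last clause of
    [uniform_draws] gives independence of [J k] from it. *)
Lemma fmean_excess_y k t (g : T -> 'I_M -> R) : (k < t)%N ->
  (forall w w', history k w = history k w' -> I k w = I k w' -> g w = g w') ->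
  exists2 phi, forall w,
    draw_excess (m%:R / M%:R) (J k w) (g w) = phi (history t w)
    & fmean Pr (history t) phi = 0.
Proof.
move=> kt gh; have [c _ DP _ ind] := draws.
pose v w := (history k w, I k w).
have gv w w' : v w = v w' -> g w = g w' by case=> h1 h2; apply: gh.
have [f fE] := factor_through (fun=> 0) gv.
exists (fun s : {ffun 'I_t -> _} => draw_excess (m%:R / M%:R)
  (s (Ordinal kt)).2 (f ([ffun j : 'I_k => s (widen_ord (ltnW kt) j)],
                         (s (Ordinal kt)).1))).
  move=> w; rewrite fE ffunE /=; congr (draw_excess _ _ (f (_, _))).
  by apply/ffunP => j; rewrite !ffunE.
have mv := measurable_pair_event (@measurable_history k) (measurable_draw_x k).
rewrite -(fmean_draw_excess (Pr := Pr) (D := J k) (v := v) f mM _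
  (measurable_draw_y k) _ _ mv).
- apply: fmean_factor => [s||w].
  + exact: measurable_history.
  + exact: measurable_pair_event mv (measurable_draw_y k).
  + rewrite ffunE /=; congr (draw_excess _ _ (f (_, _))).
    by apply/ffunP => j; rewrite !ffunE.
- by move=> w; case: (c k w).
- by move=> S cS; have [_ /(_ cS)] := DP k finset.set0 S.
- move=> [s S] V; have [S' [V' E]] := history_event s.
  have -> : [set w | v w = (s, S)]
      = drawn_before I J k S' V' `&` [set w | I k w = S].
    rewrite -E; apply/seteqP; split => w /= [h1 h2]; first by split.
    by rewrite /v h1 h2.
  exact: ind.
Qed.

End History.

(** * Consequences of the matrix conditions, and the choice of penalty weights *)

Lemma sqnorm_ge_draw {R : realType} {N : nat} {p : 'I_N -> nat} {l : nat}
    (G : group R p l) W (n : nat) (c k beta L : R) (D : {set 'I_N}) z :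
  block_diagonal W -> 0 <= beta -> 0 <= k <= c ->
  matrix_cond_joint G W (c * beta) L
  \/ matrix_cond_blockwise G W (c * n%:R * beta) L ->
  #|D| = n -> restr D z = z ->
  k * beta * dot (coupling G *m z) (coupling G *m z)
  <= sqnorm W z - L * dot z z.
Proof.
move=> Wd b0 /andP[k0 kc] cond cD Dz; rewrite lerBrDr.
case: cond => cond.
  apply: le_trans (sqnorm_ge_joint z cond); rewrite lerD2r ler_wpM2r ?dotvv_ge0 //.
  by rewrite ler_wpM2r.
apply: sqnorm_ge_blockwise Wd cond _ _ Dz; first by rewrite mulr_ge0.
by rewrite cD mulrCA mulrA ler_wpM2r // ler_wpM2r.
Qed.

(** All N blocks occur, yet the blockwise factor n suffices: the factor N lost in reassembling them
    meets theta = n / N. *)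
Lemma sqnorm_ge_full {R : realType} {N : nat} {p : 'I_N -> nat} {l : nat}
    (G : group R p l) W (n : nat) (c beta theta L : R) z :
  block_diagonal W -> 0 <= beta -> (0 < N)%N -> theta = n%:R / N%:R ->
  theta <= 1 -> 1 <= c ->
  matrix_cond_joint G W (c * beta) L
  \/ matrix_cond_blockwise G W (c * n%:R * beta) L ->
  theta * beta * dot (coupling G *m z) (coupling G *m z)
  <= sqnorm W z - L * dot z z.
Proof.
move=> Wd b0 N0 thE th1 c1 cond; rewrite lerBrDr.
have th0 : 0 <= theta by rewrite thE divr_ge0.
case: cond => cond.
  apply: le_trans (sqnorm_ge_joint z cond); rewrite lerD2r ler_wpM2r ?dotvv_ge0 //.
  by rewrite ler_wpM2r // (le_trans th1).
apply: sqnorm_ge_blockwise Wd cond _ _ (restrT z); first by rewrite mulr_ge0.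
rewrite cardsT card_ord mulrA thE mulrCA mulfV ?pnatr_eq0 -?lt0n // mulr1.
by rewrite ler_wpM2r // ler_peMl.
Qed.

(** Weight 1 + L bounds m1 + (1 + L) m2, hence m1, and with m1 >= - L m2 also m2. Weight 2 L bounds
    m1 + 2 L m2 >= L m2 >= - m1. [K] dominates both squared weights. *)
Lemma bound_of_penalized {R : realType} (m1 m2 w C beta L : R) :
  0 < beta -> 0 <= L -> 0 <= m2 -> 0 < w ->
  (forall g, 0 <= g -> w * (m1 + g * m2) <= C + g ^+ 2 / (2 * beta)) ->
  - (L * m2) <= m1 ->
  let B := w^-1 * (C + Num.max ((1 + L) ^+ 2) (4 * L ^+ 2) / (2 * beta)) in
  `|m1| <= B /\ m2 <= B.
Proof.
move=> b0 L0 m20 w0 h lo B; set K := Num.max _ _ in B *.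
have hB g : 0 <= g -> g ^+ 2 <= K -> m1 + g * m2 <= B.
  move=> g0 gK; rewrite /B ler_pdivlMl // (le_trans (h g g0)) // lerD2l.
  by rewrite ler_wpM2r // invr_ge0 mulr_ge0 // ltW.
have h1 : m1 + (1 + L) * m2 <= B.
  by apply: hB; rewrite ?addr_ge0 // /K le_max lexx.
have h2 : m1 + (2 * L) * m2 <= B.
  apply: hB; first by rewrite mulr_ge0.
  rewrite exprMn /K le_max; apply/orP; right.
  by rewrite le_eqVlt; apply/orP; left; apply/eqP; ring.
have Lm := mulr_ge0 L0 m20.
by rewrite ler_norml; split; [apply/andP; split|]; lra.
Qed.

(** * Finiteness and lower bound at primal-dual solutions *)

Section Solutions.
Context {R : realType} {N M : nat} {p : 'I_N -> nat} {q : 'I_M -> nat}.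
Context {l : nat}.
Variables (GX : group R p l) (GY : group R q l) (b : 'cV[R]_l).
Hypotheses (GXC : convex_group GX) (GYC : convex_group GY).
Implicit Types (x xs : 'cV[R]_(\sum_i p i)) (y ys : 'cV[R]_(\sum_j q j)).

Lemma total_objectiveE x y : in_domain GX x -> in_domain GY y ->
  total_objective GX GY x y = (objective_value GX x + objective_value GY y)%:E.
Proof. by move=> xd yd; rewrite /total_objective !objectiveE. Qed.

Lemma total_objective_domain x y : in_feasible GX x -> in_feasible GY y ->
  (total_objective GX GY x y < +oo)%E -> in_domain GX x /\ in_domain GY y.
Proof.
rewrite /total_objective => xf yf h.
have hx := objective_neqNy x GXC; have hy := objective_neqNy y GYC.
by split; apply: in_domain_of_lty => //; rewrite ltey;
   apply: contraTneq h => ->; rewrite ?addye ?addey // ltxx.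
Qed.

(** If the solution had value +oo, its inequality at a point of finite value would read 0 <= -oo. *)
Lemma primal_dual_domain x y xs ys (lams : 'cV[R]_l) :
  in_domain GX x -> in_domain GY y ->
  primal_dual_solution GX GY b xs ys lams ->
  in_domain GX xs /\ in_domain GY ys.
Proof.
move=> xd yd [xsf ysf _ /(_ x y (in_domain_feasible xd) (in_domain_feasible yd))].
rewrite total_objectiveE // => h; apply: total_objective_domain => //.
by move: h; case: (total_objective GX GY xs ys) => [a|//|//] _; rewrite ltry.
Qed.

Lemma primal_dual_ge x y xs ys (lams : 'cV[R]_l) :
  in_domain GX x -> in_domain GY y ->
  primal_dual_solution GX GY b xs ys lams ->
  dot lams (residual GX GY b x y)
  <= objective_value GX x + objective_value GY y
     - (objective_value GX xs + objective_value GY ys).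
Proof.
move=> xd yd pds; have [xsd ysd] := primal_dual_domain xd yd pds.
case: pds => _ _ rs /(_ x y (in_domain_feasible xd) (in_domain_feasible yd)).
rewrite !total_objectiveE // -!EFinB lee_fin.
have -> : dot (x - xs) ((coupling GX)^T *m lams)
    = dot lams (coupling GX *m (x - xs)) by rewrite dotC dot_trmx.
have -> : dot (y - ys) ((coupling GY)^T *m lams)
    = dot lams (coupling GY *m (y - ys)) by rewrite dotC dot_trmx.
have -> : residual GX GY b x y
    = coupling GX *m (x - xs) + coupling GY *m (y - ys).
  rewrite -[LHS]subr0 -rs /residual !mulmxBr.
  by apply/colP => i; rewrite !mxE; ring.
rewrite dotDr; lra.
Qed.

End Solutions.

(** * Assembly of the expectation bound *)

Theorem theorem3p8 (R : realType) (N M : nat)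
    (p : 'I_N -> nat) (q : 'I_M -> nat) (l : nat)
    (GX : group R p l) (GY : group R q l) (b : 'cV[R]_l)
    (n m : nat) (L_f L_g rho rho_x rho_y theta : R)
    (Phat : 'M[R]_(\sum_i p i)) (Qhat : 'M[R]_(\sum_j q j))
    (x0 : 'cV[R]_(\sum_i p i)) (y0 : 'cV[R]_(\sum_j q j))
    (d : measure_display) (T : measurableType d) (Pr : probability T R)
    (I : nat -> T -> {set 'I_N}) (J : nat -> T -> {set 'I_M})
    (x : nat -> T -> 'cV[R]_(\sum_i p i))
    (y : nat -> T -> 'cV[R]_(\sum_j q j))
    (lam r : nat -> T -> 'cV[R]_l)
    (xs : 'cV[R]_(\sum_i p i)) (ys : 'cV[R]_(\sum_j q j)) (lams : 'cV[R]_l)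
    (t : nat) :
  (1 <= n <= N)%N -> (1 <= m <= M)%N ->
  convex_group GX -> convex_group GY ->
  lipschitz_partial_grad GX n L_f -> lipschitz_partial_grad GY m L_g ->
  0 < rho -> 0 < rho_x -> 0 < rho_y ->
  psd Phat -> block_diagonal Phat -> psd Qhat -> block_diagonal Qhat ->
  in_feasible GX x0 -> in_feasible GY y0 ->
  (total_objective GX GY x0 y0 < +oo)%E ->
  rpdbu GX GY b Pr n m rho rho_x rho_y Phat Qhat x0 y0 I J x y lam r ->
  rho = n%:R * rho_x / N%:R -> rho = m%:R * rho_y / M%:R ->
  theta = n%:R / N%:R -> theta = m%:R / M%:R ->
  (matrix_cond_joint GX Phat
     ((2 - theta) * ((1 - theta) / theta ^+ 2 + 1) * rho_x) L_f
   /\ matrix_cond_joint GY Qhat ((2 - theta) / theta ^+ 2 * rho_y) L_g)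
  \/
  (matrix_cond_blockwise GX Phat
     ((2 - theta) * ((1 - theta) / theta ^+ 2 + 1) * n%:R * rho_x) L_f
   /\ matrix_cond_blockwise GY Qhat
        ((2 - theta) / theta ^+ 2 * m%:R * rho_y) L_g) ->
  primal_dual_solution GX GY b xs ys lams ->
  (1 <= t)%N ->
  let xhat := fun w => weighted_average theta t (fun k => x k w) in
  let yhat := fun w => weighted_average theta t (fun k => y k w) in
  let Ptilde := Phat - (theta * rho_x) *: ((coupling GX)^T *m coupling GX) in
  let Phi := total_objective GX GY in
  (maxe `| \int[Pr]_w (Phi (xhat w) (yhat w) - Phi xs ys) |
        (\int[Pr]_w (enorm (residual GX GY b (xhat w) (yhat w)))%:E)
   <= ((1 + theta * t%:R)^-1)%:E *
      ((1 - theta)%:E *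
         (Phi x0 y0 - Phi xs ys
          + (rho_x * enorm (residual GX GY b x0 y0) ^+ 2)%:E)
       + (2^-1 * sqnorm Ptilde (x0 - xs)
          + 2^-1 * sqnorm Qhat (y0 - ys)
          + Num.max ((1 + enorm lams) ^+ 2) (4 * enorm lams ^+ 2)
            / (2 * rho_x))%:E))%E.
Proof.
move=> nN mM GXC GYC GXL GYL rho0 rx0 ry0 Pp Pd Qp Qd x0f y0f T0 run.
move=> rhox rhoy thx thy cond pds t1; cbv zeta.
set xhat := fun w => weighted_average theta t (fun k => x k w).
set yhat := fun w => weighted_average theta t (fun k => y k w).
set Ptilde := Phat - _; set Phi := total_objective GX GY.
have [draws nona init step] := run.
have [n0 nleN] := andP nN; have [m0 mleM] := andP mM.
have N0 : (0 < N)%N by apply: leq_trans nleN.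
have M0 : (0 < M)%N by apply: leq_trans mleM.
have th0 : 0 < theta by rewrite thx divr_gt0 // ltr0n.
have th1 : theta <= 1 by rewrite thx ler_pdivrMr ?ltr0n // mul1r ler_nat.
have rhoE : rho = theta * rho_x by rewrite rhox thx mulrAC.
(* Both formulas for [rho] are [theta] times a penalty, so one [beta] serves both groups. *)
have ryE : rho_y = rho_x.
  apply: (mulfI (lt0r_neq0 th0)).
  by rewrite -rhoE rhoy thy mulrAC.
subst rho_y.
have th01 : 0 <= theta <= 1 by rewrite ltW.
have invsq : 1 <= (theta ^+ 2)^-1.
  by rewrite invf_ge1 ?exprn_gt0 // exprn_ile1 // ltW.
set cP := (2 - theta) * ((1 - theta) / theta ^+ 2 + 1) in cond.
set cQ := (2 - theta) / theta ^+ 2 in cond.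
have cP1 : 1 <= cP.
  have h : 0 <= (1 - theta) / theta ^+ 2.
    by rewrite divr_ge0 ?subr_ge0 // exprn_ge0 // ltW.
  by rewrite /cP; apply: mulr_ege1; lra.
have cQ1 : 2 - theta <= cQ by rewrite /cQ ler_peMr //; lra.
have condX : matrix_cond_joint GX Phat (cP * rho_x) L_f
    \/ matrix_cond_blockwise GX Phat (cP * n%:R * rho_x) L_f.
  by case: cond => -[]; [left|right].
have condY : matrix_cond_joint GY Qhat (cQ * rho_x) L_g
    \/ matrix_cond_blockwise GY Qhat (cQ * m%:R * rho_x) L_g.
  by case: cond => -[]; [left|right].
have P_draw (D : {set 'I_N}) z : #|D| = n -> restr D z = z ->
    rho_x * dot (coupling GX *m z) (coupling GX *m z)
    <= sqnorm Phat z - L_f * dot z z.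
  move=> cD Dz; rewrite -[rho_x]mul1r.
  by apply: (sqnorm_ge_draw Pd (ltW rx0) _ condX cD Dz); rewrite ler01.
have Q_draw (D : {set 'I_M}) z : #|D| = m -> restr D z = z ->
    (2 - theta) * rho_x * dot (coupling GY *m z) (coupling GY *m z)
    <= sqnorm Qhat z - L_g * dot z z.
  move=> cD Dz; apply: (sqnorm_ge_draw Qd (ltW rx0) _ condY cD Dz).
  by apply/andP; split => //; lra.
have P_full z : theta * rho_x * dot (coupling GX *m z) (coupling GX *m z)
    <= sqnorm Phat z.
  have := sqnorm_ge_full z Pd (ltW rx0) N0 thx th1 cP1 condX.
  have := lipschitz_dot_ge0 z nN GXL; lra.
have [x0d y0d] := total_objective_domain GXC GYC x0f y0f T0.
have [xsd ysd] := primal_dual_domain GXC GYC x0d y0d pds.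
have [cIJ _ _ _ _] := draws.
have pb w := path_bound GXC GYC GXL GYL Pp Pd Qp Qd rx0 th01 P_draw Q_draw P_full
  (I := I^~ w) (J := J^~ w) (x := x^~ w) (y := y^~ w) (lam := lam^~ w)
  (r := r^~ w) (xs := xs) (ys := ys) (b := b).
have init0 w : [/\ x 0%N w = x0, y 0%N w = y0, lam 0%N w = 0
  & r 0%N w = residual GX GY b x0 y0] by apply: init.
have x0w w : in_domain GX (x 0%N w) by case: (init0 w) => -> _ _ _.
have y0w w : in_domain GY (y 0%N w) by case: (init0 w) => _ -> _ _.
have lam0w w : lam 0%N w = 0 by case: (init0 w).
have r0w w : r 0%N w = residual GX GY b (x 0%N w) (y 0%N w).
  by case: (init0 w) => -> -> _ ->.
have xup k w : block_update GX Phat rho_x (I k w) (x k w) (lam k w) (r k w)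
    (x k.+1 w) by case: (step k w).
have yup k w : block_update GY Qhat rho_x (J k w) (y k w) (lam k w)
    (r k w + coupling GX *m restr (I k w) (x k.+1 w - x k w)) (y k.+1 w).
  by case: (step k w).
have rE k w : r k.+1 w = r k w + coupling GX *m restr (I k w) (x k.+1 w - x k w)
    + coupling GY *m restr (J k w) (y k.+1 w - y k w) by case: (step k w).
have lamE k w : lam k.+1 w = lam k w - (theta * rho_x) *: r k.+1 w.
  by rewrite -rhoE; case: (step k w).
have xsr : residual GX GY b xs ys = 0 by case: pds.
have {}pb w g (g0 : 0 <= g) := pb w (x0w w) (y0w w) xsd ysd (r0w w) xsr
  (fun k => (cIJ k w).1) (fun k => (cIJ k w).2) (xup^~ w) (yup^~ w) (rE^~ w)
  (lamE^~ w) g t g0 (lam0w w).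
have xd k w : in_domain GX (x k w).
  exact: (path_in_domain_x GXC (x0w w) (xup^~ w)).
have yd k w : in_domain GY (y k w).
  exact: (path_in_domain_y GYC (y0w w) (yup^~ w)).
have [xhd yhd] : (forall w, in_domain GX (xhat w))
    /\ (forall w, in_domain GY (yhat w)).
  split=> w.
    by have [] := weighted_average_objective t GXC (ltW th0) (xd^~ w).
  by have [] := weighted_average_objective t GYC (ltW th0) (yd^~ w).
(* [nonanticipating] covers [x] and [y]; [r] and [lam] follow by recursion. The iterates are not
   assumed measurable: this dependence on finitely many draws makes their means finite sums. *)
have dep k w w' : same_draws_before I J k w w' ->
    [/\ x k w = x k w', y k w = y k w', r k w = r k w' & lam k w = lam k w'].
  elim: k => [|k IH] sd.
    by have [-> -> -> ->] := init0 w; have [-> -> -> ->] := init0 w'.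
  have sd' : same_draws_before I J k w w' by move=> j jk; apply/sd/ltnW.
  have [Ik Jk] := sd k (ltnSn k).
  have [xk yk] := nona k w w' sd' Ik; have {}yk := yk Jk.
  have [xk0 yk0 rk0 lk0] := IH sd'.
  have rk : r k.+1 w = r k.+1 w' by rewrite !rE Ik Jk xk yk xk0 yk0 rk0.
  by split => //; rewrite !lamE rk lk0.
(* The averages involve [x t.+1] and [y t.+1], determined by the draws 0 to t, hence a history of
   length [t.+1]. *)
pose H := history I J t.+1.
have hsd k w w' : (k <= t.+1)%N -> H w = H w' -> same_draws_before I J k w w'.
  move=> kt /history_eqP sd j jk; apply: sd; exact: leq_trans jk kt.
have xyh w w' : H w = H w' -> xhat w = xhat w' /\ yhat w = yhat w'.
  move=> E; have xy k : (k <= t.+1)%N -> x k w = x k w' /\ y k w = y k w'.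
    by move=> kt; have [-> ->] := dep k w w' (hsd _ _ _ kt E).
  rewrite /xhat /yhat /weighted_average.
  have [-> ->] := xy _ (leqnn _).
  by split; congr (_ *: (_ + _ *: _)); apply: eq_big_nat => k /andP[_ kt];
     have [xk yk] := xy k (ltnW kt); rewrite ?xk ?yk.
pose gap w := objective_value GX (xhat w) + objective_value GY (yhat w)
  - (objective_value GX xs + objective_value GY ys).
pose err w := enorm (residual GX GY b (xhat w) (yhat w)).
have [gapF gapE] : exists f, forall w, gap w = f (H w).
  by apply: (factor_through 0) => w w' /xyh[E1 E2]; rewrite /gap E1 E2.
have [errF errE] : exists f, forall w, err w = f (H w).
  by apply: (factor_through 0) => w w' /xyh[E1 E2]; rewrite /err E1 E2.
pose exc w k := excess GX GY rho_x theta (I^~ w) (J^~ w) (x^~ w) (y^~ w)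
  (lam^~ w) (r^~ w) xs ys k.
have mH s : measurable [set w | H w = s] by apply: (measurable_history draws).
have : forall k : 'I_t.+1, exists f,
    (forall w, exc w k = f (H w)) /\ fmean Pr H f = 0.
  move=> k.
  pose gX w := block_gap GX rho_x (lam k w) (r k w) xs (x k w).
  pose gY w := block_gap GY rho_x (lam k w)
    (r k w + coupling GX *m restr (I k w) (x k.+1 w - x k w)) ys (y k w).
  have gXdep w w' : history I J k w = history I J k w' -> gX w = gX w'.
    by move/history_eqP/dep => [xk _ rk lk]; rewrite /gX xk rk lk.
  have gYdep w w' : history I J k w = history I J k w' -> I k w = I k w' ->
      gY w = gY w'.
    move/history_eqP => sd Ik; have [xk yk rk lk] := dep _ _ _ sd.
    by have [x1 _] := nona k w w' sd Ik; rewrite /gY xk yk rk lk Ik x1.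
  have [fx fxE fx0] := fmean_excess_x nN draws (ltn_ord k) gXdep.
  have [fy fyE fy0] := fmean_excess_y mM draws (ltn_ord k) gYdep.
  exists (fun s => fx s + fy s); split; last by rewrite fmeanD fx0 fy0 addr0.
  by move=> w; rewrite -fxE -fyE -thx -thy.
move=> /choice[excF excP].
set C := (1 - theta) * (objective_value GX x0 + objective_value GY y0
     - (objective_value GX xs + objective_value GY ys)
     + rho_x * enorm (residual GX GY b x0 y0) ^+ 2)
  + (2^-1 * sqnorm Ptilde (x0 - xs) + 2^-1 * sqnorm Qhat (y0 - ys)).
have w0 : 0 < 1 + theta * t%:R by rewrite ltr_wpDr // mulr_ge0 // ltW.
have pen g : 0 <= g -> (1 + theta * t%:R) * (fmean Pr H gapF + g * fmean Pr H errF)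
    <= C + g ^+ 2 / (2 * rho_x).
  move=> g0.
  have -> : (1 + theta * t%:R) * (fmean Pr H gapF + g * fmean Pr H errF)
    = fmean Pr H (fun s => (1 + theta * t%:R) * (gapF s + g * errF s)
        + \sum_(k < t.+1) excF k s).
    rewrite fmeanD fmeanZ fmeanD fmeanZ fmean_sum big1 ?addr0 // => k _.
    by case: (excP k).
  rewrite -(fmean_cst Pr mH (C + g ^+ 2 / (2 * rho_x))).
  apply: fmean_le => // w; rewrite -gapE -errE.
  have -> : \sum_(k < t.+1) excF k (H w) = \sum_(k < t.+1) exc w k.
    by apply: eq_bigr => k _; case: (excP k).
  apply: (le_trans (pb w g g0)).
  rewrite /gap_value; have [-> -> _ ->] := init0 w.
  by rewrite /C sqr_enorm /Ptilde sqnormDl sqnormNl sqnormZl sqnorm_gram !addrA.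
have err0 : 0 <= fmean Pr H errF.
  rewrite -(fmean_cst Pr mH 0); apply: fmean_le => // w.
  by rewrite -errE enorm_ge0.
have low : - (enorm lams * fmean Pr H errF) <= fmean Pr H gapF.
  rewrite -mulNr -fmeanZ; apply: fmean_le => // w; rewrite -gapE -errE.
  apply: le_trans (primal_dual_ge GXC GYC (xhd w) (yhd w) pds).
  have := normr_dot_le lams (residual GX GY b (xhat w) (yhat w)).
  by rewrite ler_norml mulNr => /andP[].
have [B1 B2] := bound_of_penalized rx0 (enorm_ge0 lams) err0 w0 pen low.
have -> : (\int[Pr]_w (Phi (xhat w) (yhat w) - Phi xs ys)
    = (fmean Pr H gapF)%:E)%E.
  rewrite -integral_fmean //; apply: eq_integral => w _.
  by rewrite /Phi !total_objectiveE // -EFinB -gapE.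
have -> : (\int[Pr]_w (enorm (residual GX GY b (xhat w) (yhat w)))%:E
    = (fmean Pr H errF)%:E)%E.
  by rewrite -integral_fmean //; apply: eq_integral => w _; rewrite -errE.
rewrite /Phi !total_objectiveE //.
rewrite [X in (_ <= X)%E](_ : _ = ((1 + theta * t%:R)^-1 * (C
  + Num.max ((1 + enorm lams) ^+ 2) (4 * enorm lams ^+ 2) / (2 * rho_x)))%:E).
  by rewrite ge_max abse_EFin !lee_fin B1.
by rewrite /C -[X in _ = (_ * X)%:E]addrA.
Qed.
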